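(* Let $\rho>1$ and let $f$ be analytic inside and on the Bernstein ellipse $\mathcal{E}_\rho$. For $n\ge1$ let $\{x_j\}_{j=0}^n$ be the Legendre-Gauss-Lobatto points, i.e. the zeros of $\phi_n^{\mathrm{LGL}}(x)=P_{n+1}(x)-P_{n-1}(x)$, and let $p_n$ be the unique polynomial of degree at most $n$ which interpolates $f$ at these points. Then $$\|f-p_n\|_{L^\infty(\Omega)}\le\frac{\mathcal{K}\sqrt2\,M(\rho)L(\mathcal{E}_\rho)}{\mathrm{d}(\Omega,\mathcal{E}_\rho)\,\pi\sqrt{\rho^2-1}}\,\frac{1}{\rho^n}$$ and $$\max_{0\le j\le n}|f'(x_j)-p_n'(x_j)|\le\frac{\mathcal{K}\sqrt2\,M(\rho)L(\mathcal{E}_\rho)}{\mathrm{d}(\Omega,\mathcal{E}_\rho)\sqrt{\pi(\rho^2-1)}}\,\frac{n^{3/2}}{\rho^n},$$ where $\mathcal{K}$ is a generic positive constant with $\mathcal{K}\approx1$ for $n\gg1$; that is, $\mathcal{K}=\mathcal{K}_n>0$ depends on $n$ and $\rho$ but not on $f$, and $\mathcal{K}_n\to1$ as $n\to\infty$ (the sequences $\mathcal{K}_n$ in the two bounds need not be the same).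
   Context: $\Omega=[-1,1]$. $P_k(x)$ denotes the Legendre polynomial of degree $k$, normalized by $P_k(1)=1$. The Bernstein ellipse is $\mathcal{E}_\rho=\{z\in\mathbb{C}: z=(u+u^{-1})/2,\ u=\rho e^{\mathrm{i}\theta},\ 0\le\theta<2\pi\}$. $M(\rho)=\max_{z\in\mathcal{E}_\rho}|f(z)|$, $L(\mathcal{E}_\rho)$ is the length of the circumference of $\mathcal{E}_\rho$, and $\mathrm{d}(\Omega,\mathcal{E}_\rho)$ is the distance from $\Omega$ to $\mathcal{E}_\rho$. *)

(* Defs.v *)
From Stdlib Require Import Reals Lra Lia.
From Coquelicot Require Import Coquelicot.
Open Scope R_scope.

(** Legendre polynomials, by Bonnet's recurrence
    [(k+1) P_(k+1) = (2k+1) x P_k - k P_(k-1)], read with [k+1 = k''+2]. *)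
Fixpoint legendre (k : nat) (x : R) : R :=
  match k with
  | O => 1
  | S k' =>
      match k' with
      | O => x
      | S k'' =>
          ((2 * INR k'' + 3) * x * legendre k' x - (INR k'' + 1) * legendre k'' x)
          / (INR k'' + 2)
      end
  end.

Lemma legendre_at_1 (k : nat) : legendre k 1 = 1.
Proof.
enough (H : legendre k 1 = 1 /\ legendre (S k) 1 = 1) by apply H.
induction k as [|k [IH1 IH2]]; [now split|].
split; [exact IH2|].
change (((2 * INR k + 3) * 1 * legendre (S k) 1 - (INR k + 1) * legendre k 1)
        / (INR k + 2) = 1).
rewrite IH1, IH2. pose proof (pos_INR k). field. lra.
Qed.

(** Meant for [1 <= n] only. *)
Definition phi_LGL (n : nat) (x : R) : R :=
  legendre (n + 1) x - legendre (n - 1) x.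

(** [x 0, ..., x n] lists the zeros of [phi_LGL n], each once, in any order. *)
Definition is_LGL_points (n : nat) (x : nat -> R) : Prop :=
  (forall i j, (i <= n)%nat -> (j <= n)%nat -> x i = x j -> i = j) /\
  (forall t : R, phi_LGL n t = 0 <-> exists j, (j <= n)%nat /\ t = x j).

Definition Omega (z : C) : Prop :=
  exists x : R, -1 <= x <= 1 /\ z = RtoC x.

Definition bernstein_param (rho theta : R) : C :=
  let u : C := (RtoC rho * (cos theta, sin theta))%C in ((u + / u) / 2)%C.

Definition bernstein_ellipse (rho : R) (z : C) : Prop :=
  exists theta : R, 0 <= theta < 2 * PI /\ z = bernstein_param rho theta.

(** The ellipse is centred at [0], so the points inside or on it are those of
    the segments joining [0] to its points. *)
Definition bernstein_region (rho : R) (z : C) : Prop :=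
  exists (t : R) (w : C),
    0 <= t <= 1 /\ bernstein_ellipse rho w /\ z = (RtoC t * w)%C.

(** [f] is the sum of a convergent power series around [z0]; this makes it
    analytic on a whole neighbourhood of [z0]. *)
Definition analytic_at (f : C -> C) (z0 : C) : Prop :=
  exists (a : nat -> C) (r : R), 0 < r /\
    forall z : C, Cmod (z - z0) < r ->
      @is_pseries C_AbsRing C_NormedModule a (z - z0)%C (f z).

Definition is_poly_deg_le (n : nat) (p : C -> C) : Prop :=
  exists c : nat -> C, forall z : C,
    p z = sum_n (fun k => (c k * Cpow z k)%C) n.

Definition sup_norm (S : C -> Prop) (g : C -> C) : Rbar :=
  Lub_Rbar (fun y => exists z : C, S z /\ y = Cmod (g z)).

(** The supremum is a maximum as soon as [f] is continuous on the ellipse, which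
    is compact. *)
Definition M_ellipse (f : C -> C) (rho : R) : R :=
  real (sup_norm (bernstein_ellipse rho) f).

Definition curve_length (g : R -> C) (a b : R) : R :=
  RInt (fun t => Cmod (Derive (fun s => Re (g s)) t, Derive (fun s => Im (g s)) t)) a b.

Definition L_ellipse (rho : R) : R :=
  curve_length (bernstein_param rho) 0 (2 * PI).

Definition set_dist (A B : C -> Prop) : R :=
  real (Glb_Rbar (fun d => exists z w : C, A z /\ B w /\ d = Cmod (z - w))).

(* Main.v *)
(** Write [phi = P_(n+1) - P_(n-1)]. Contracting the ellipse to a point [y] of [[-1,1]]
    gives Cauchy's formula on it, and expanding [1/(z-y)] in Newton's form at the nodes
    gives the remainder
    [f(y) - p(y) = phi(y)/(2 pi i) * int f(z)/(phi(z)(z-y)) dz].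
    Hence [|f - p| <= A |phi|] on [[-1,1]] with [A = M L/(2 pi d min|phi|)], and letting
    [y] tend to a node, [|f' - p'| <= A |phi'| = A (2n+1) |P_n| <= A (2n+1)] there.

    Let [g_k = C(2k,k)/4^k]. Since [(1-x^2) phi'' + n(n+1) phi = 0], Sonin's function
    [phi^2 + (1-x^2) phi'^2/(n(n+1))] is maximal at [0], whence
    [|phi| <= sqrt 2 g_n (2n+1)/n] on [[-1,1]]. In
    [P_n((u+1/u)/2) = sum g_k g_(n-k) u^(n-2k)] all coefficients are positive, while in the
    expansion of [phi] only the two extreme ones are, so up to an exponentially small term
    [|phi|] on the ellipse is at least its value at the vertex [(rho+1/rho)/2], which is
    asymptotic to [g_n rho^n sqrt(rho^2-1)] because [sum g_k q^k = 1/sqrt(1-q)]. The second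
    bound only needs [g_n >= 1/(2 sqrt n)]. *)

Require Import Defs.
From Stdlib Require Import Reals Lra Lia.
From Coquelicot Require Import Coquelicot.
Open Scope R_scope.

(** * Laurent expansion of Legendre polynomials *)

(** In the first bound the limit 1 of the constants leaves no room. The maximum of |phi| on [-1,1]
    and its minimum on the ellipse are therefore measured in the same unit g_n, and the remaining
    quotient is followed to its exact limit; a crude estimate is allowed only if its effect
    disappears as n grows.

    Cauchy's formula is drawn from one fact about real integrals: if d/dt g = d/dth h with h
    periodic in th, then the integral of g over a period does not depend on t. It serves twice, for
    the contraction of the contour and for the winding number. What it asks of f is a continuous
    derivative. Strict differentiability, where both points of the difference quotient move,
    provides it: a geometric majorant of the power series gives it at each point, and continuity of
    the derivative is then automatic.

    The interpolant p is known only through its degree and its values at the nodes. It is identified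
    with the Newton part of the remainder formula by counting the zeros of a difference, so Newton's
    coefficients never have to be computed. *)

Lemma Csum_S (F : nat -> C) n : sum_n F (S n) = (sum_n F n + F (S n))%C.
Proof. exact (sum_Sn F n). Qed.

Lemma Rsum_S (F : nat -> R) n : sum_n F (S n) = sum_n F n + F (S n).
Proof. exact (sum_Sn F n). Qed.

Lemma Csum_ext (F G : nat -> C) n :
  (forall k, (k <= n)%nat -> F k = G k) -> sum_n F n = sum_n G n :> C.
Proof. exact (sum_n_ext_loc F G n). Qed.

Lemma Csum_shift (F : nat -> C) n :
  sum_n F (S n) = (F 0%nat + sum_n (fun k => F (S k)) n)%C.
Proof.
induction n as [|n IH].
- now rewrite Csum_S, !sum_O.
- now rewrite Csum_S, IH, (Csum_S (fun k => F (S k))), Cplus_assoc.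
Qed.

Lemma Csum_plus (F G : nat -> C) n :
  sum_n (fun k => F k + G k)%C n = (sum_n F n + sum_n G n)%C.
Proof. exact (sum_n_plus F G n). Qed.

Lemma Csum_scal (c : C) (F : nat -> C) n :
  sum_n (fun k => c * F k)%C n = (c * sum_n F n)%C.
Proof. exact (sum_n_mult_l (c : C_Ring) F n). Qed.

Lemma RtoC_sum (F : nat -> R) n : RtoC (sum_n F n) = sum_n (fun k => RtoC (F k)) n.
Proof.
induction n as [|n IH]; [now rewrite !sum_O|].
now rewrite Csum_S, Rsum_S, RtoC_plus, IH.
Qed.

Lemma Cmod_sum (F : nat -> C) n : Cmod (sum_n F n) <= sum_n (fun k => Cmod (F k)) n.
Proof.
induction n as [|n IH]; [rewrite !sum_O; lra|].
rewrite Csum_S, Rsum_S. eapply Rle_trans; [apply Cmod_triangle|]. lra.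
Qed.

Lemma Rsum_le (F G : nat -> R) n :
  (forall k, (k <= n)%nat -> F k <= G k) -> sum_n F n <= sum_n G n.
Proof.
induction n as [|n IH]; intros H; [rewrite !sum_O; auto|].
rewrite !Rsum_S. apply Rplus_le_compat; auto.
Qed.

(** [cbin k] is the binomial coefficient [C(2k,k)] divided by [4^k]. *)
Fixpoint cbin (k : nat) : R :=
  match k with
  | O => 1
  | S k' => cbin k' * ((2 * INR k' + 1) / (2 * INR k' + 2))
  end.

Lemma cbin_S k : cbin (S k) = cbin k * ((2 * INR k + 1) / (2 * INR k + 2)).
Proof. reflexivity. Qed.

Lemma cbin_pos k : 0 < cbin k.
Proof.
induction k as [|k IH]; [simpl; lra|]. rewrite cbin_S.
pose proof (pos_INR k). apply Rmult_lt_0_compat; [easy|].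
apply Rdiv_lt_0_compat; lra.
Qed.

Lemma cbin_S_le k : cbin (S k) <= cbin k.
Proof.
rewrite cbin_S. pose proof (pos_INR k). pose proof (cbin_pos k).
rewrite <- (Rmult_1_r (cbin k)) at 2. apply Rmult_le_compat_l; [lra|].
apply Rle_div_l; lra.
Qed.

Lemma cbin_le j k : (j <= k)%nat -> cbin k <= cbin j.
Proof.
induction 1 as [|k _ IH]; [apply Rle_refl|]. pose proof (cbin_S_le k). lra.
Qed.

Lemma cbin_le_1 k : cbin k <= 1.
Proof. exact (cbin_le 0 k (Nat.le_0_l k)). Qed.

(** The Legendre recurrence made homogeneous: [laurent n u (1/u)] is the Laurent
    expansion of [P_n((u+1/u)/2)]. *)
Definition laurent (n : nat) (p s : C) : C :=
  sum_n (fun k => RtoC (cbin k * cbin (n - k)) * (Cpow s k * Cpow p (n - k)))%C n.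

(** Multiplying by [p] or [s] shifts a sum by one place, so all sums can be written on the monomials
    s^(k+1) p^(n+1-k), 0 <= k <= n, with p^(n+2) and s^(n+2) apart. The recurrence then holds
    coefficient by coefficient, as a rational identity in k and n-k once every [cbin] is reduced to
    [cbin k] and [cbin (n - k)]. *)
Lemma laurent_rec n (p s : C) :
  ((INR n + 2)%R * laurent (S (S n)) p s =
   (2 * INR n + 3)%R * ((p + s) / 2) * laurent (S n) p s
   - (INR n + 1)%R * (p * s) * laurent n p s)%C.
Proof.
set (A := sum_n (fun k => RtoC (cbin (S k) * cbin (S n - k))
                          * (Cpow s (S k) * Cpow p (S n - k)))%C n).
set (B1 := sum_n (fun k => RtoC (cbin (S k) * cbin (n - k))
                          * (Cpow s (S k) * Cpow p (S n - k)))%C n).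
set (B2 := sum_n (fun k => RtoC (cbin k * cbin (S n - k))
                          * (Cpow s (S k) * Cpow p (S n - k)))%C n).
set (D := sum_n (fun k => RtoC (cbin k * cbin (n - k))
                          * (Cpow s (S k) * Cpow p (S n - k)))%C n).
assert (E2 : laurent (S (S n)) p s =
  (RtoC (cbin (S (S n))) * Cpow p (S (S n)) + A
   + RtoC (cbin (S (S n))) * Cpow s (S (S n)))%C).
{ unfold laurent. rewrite Csum_S, Csum_shift, Nat.sub_diag, Nat.sub_0_r.
  fold A. change (cbin 0) with 1. rewrite !Rmult_1_r, !Rmult_1_l.
  change (sum_n _ n) with A. simpl Cpow. ring. }
assert (E1 : (p * laurent (S n) p s)%C =
  (RtoC (cbin (S n)) * Cpow p (S (S n)) + B1)%C).
{ unfold laurent. rewrite Csum_shift, Nat.sub_0_r.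
  change (cbin 0) with 1. rewrite Rmult_1_l.
  rewrite Cmult_plus_distr_l, <- Csum_scal. apply (f_equal2 Cplus); [simpl Cpow; ring|].
  apply Csum_ext. intros k Hk. simpl (S n - S k)%nat.
  rewrite (Nat.sub_succ_l k n Hk). simpl Cpow. ring. }
assert (E1' : (s * laurent (S n) p s)%C =
  (RtoC (cbin (S n)) * Cpow s (S (S n)) + B2)%C).
{ unfold laurent. rewrite Csum_S, Nat.sub_diag.
  change (cbin 0) with 1. rewrite Rmult_1_r.
  rewrite Cmult_plus_distr_l, <- Csum_scal, Cplus_comm. apply (f_equal2 Cplus); [simpl Cpow; ring|].
  apply Csum_ext. intros k Hk. simpl Cpow. ring. }
assert (E0 : (p * s * laurent n p s)%C = D).
{ unfold laurent. rewrite <- Csum_scal. apply Csum_ext. intros k Hk.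
  rewrite (Nat.sub_succ_l k n Hk). simpl Cpow. ring. }
assert (EM : (RtoC (INR n + 2) * A =
   RtoC ((2 * INR n + 3) / 2) * (B1 + B2) - RtoC (INR n + 1) * D)%C).
{ replace (RtoC ((2 * INR n + 3) / 2) * (B1 + B2) - RtoC (INR n + 1) * D)%C
    with (RtoC ((2 * INR n + 3) / 2) * B1 + RtoC ((2 * INR n + 3) / 2) * B2
          + RtoC (- (INR n + 1)) * D)%C
    by (rewrite RtoC_opp; ring).
  unfold A, B1, B2, D. rewrite <- !Csum_scal, <- !Csum_plus.
  apply Csum_ext. intros k Hk.
  rewrite !Cmult_assoc, <- !RtoC_mult.
  rewrite <- !Cmult_plus_distr_r, <- !RtoC_plus.
  rewrite <- !Cmult_assoc. apply (f_equal2 Cmult); [|reflexivity]. f_equal.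
  rewrite (Nat.sub_succ_l k n Hk), !cbin_S.
  assert (HI : INR n = INR k + INR (n - k)) by (rewrite <- plus_INR; f_equal; lia).
  rewrite HI. pose proof (pos_INR k). pose proof (pos_INR (n - k)). field. lra. }
replace (RtoC (2 * INR n + 3) * ((p + s) / 2) * laurent (S n) p s)%C
  with (RtoC ((2 * INR n + 3) / 2) * (p * laurent (S n) p s + s * laurent (S n) p s))%C.
2:{ unfold Rdiv. rewrite RtoC_mult, RtoC_inv by lra. unfold Cdiv. ring. }
replace (RtoC (INR n + 1) * (p * s) * laurent n p s)%C
  with (RtoC (INR n + 1) * (p * s * laurent n p s))%C by ring.
rewrite E2, E1, E1', E0.
replace (RtoC (INR n + 2) * (RtoC (cbin (S (S n))) * Cpow p (S (S n)) + A
   + RtoC (cbin (S (S n))) * Cpow s (S (S n))))%C with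
  (RtoC ((INR n + 2) * cbin (S (S n))) * (Cpow p (S (S n)) + Cpow s (S (S n)))
   + RtoC (INR n + 2) * A)%C by (rewrite RtoC_mult; ring).
rewrite EM.
replace ((INR n + 2) * cbin (S (S n))) with ((2 * INR n + 3) / 2 * cbin (S n)).
2:{ rewrite (cbin_S (S n)), S_INR. pose proof (pos_INR n). field. lra. }
rewrite RtoC_mult. ring.
Qed.

Fixpoint legendreC (k : nat) (z : C) : C :=
  match k with
  | O => 1
  | S k' =>
      match k' with
      | O => z
      | S k'' =>
          (((2 * INR k'' + 3)%R * z * legendreC k' z - (INR k'' + 1)%R * legendreC k'' z)
          / (INR k'' + 2)%R)%C
      end
  end.

Lemma legendreC_rec k z : legendreC (S (S k)) z =
  (((2 * INR k + 3)%R * z * legendreC (S k) z - (INR k + 1)%R * legendreC k z)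
          / (INR k + 2)%R)%C.
Proof. reflexivity. Qed.

Lemma legendre_rec k x : legendre (S (S k)) x =
  ((2 * INR k + 3) * x * legendre (S k) x - (INR k + 1) * legendre k x)
          / (INR k + 2).
Proof. reflexivity. Qed.

Lemma pair_ind (P : nat -> Prop) :
  P 0%nat -> P 1%nat -> (forall n, P n -> P (S n) -> P (S (S n))) -> forall n, P n.
Proof.
intros H0 H1 HS n. enough (P n /\ P (S n)) by tauto.
induction n as [|n [IH1 IH2]]; auto.
Qed.

Lemma legendreC_RtoC k x : legendreC k (RtoC x) = RtoC (legendre k x).
Proof.
induction k as [| |k IH1 IH2] using pair_ind; [reflexivity|reflexivity|].
rewrite legendreC_rec, legendre_rec, IH1, IH2.
pose proof (pos_INR k).
rewrite RtoC_div, RtoC_minus, !RtoC_mult by lra. reflexivity.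
Qed.

Lemma RtoC_neq_0 (x : R) : x <> 0 -> RtoC x <> 0%C.
Proof. intros H E. apply H. now injection E. Qed.

Lemma legendreC_laurent n (p s : C) : (p * s = 1)%C ->
  legendreC n ((p + s) / 2)%C = laurent n p s.
Proof.
intros Hps.
induction n as [| |n IH1 IH2] using pair_ind.
- unfold laurent. rewrite sum_O. simpl. rewrite Rmult_1_l. ring.
- unfold laurent. rewrite Csum_S, sum_O. simpl.
  replace (1 * (1 * ((2 * 0 + 1) / (2 * 0 + 2)))) with (/ 2) by field.
  replace (1 * ((2 * 0 + 1) / (2 * 0 + 2)) * 1) with (/ 2) by field.
  rewrite RtoC_inv by lra. field.
- rewrite legendreC_rec, IH1, IH2.
  pose proof (pos_INR n).
  assert (Hn : RtoC (INR n + 2) <> 0%C) by (apply RtoC_neq_0; lra).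
  (* The last term of Bonnet's recurrence receives the factor [p * s = 1] that the homogeneous form
     carries. *)
  rewrite <- (Cmult_1_r (RtoC (INR n + 1))), <- Hps at 1.
  rewrite <- laurent_rec. field. exact Hn.
Qed.

Definition phiC (n : nat) (z : C) : C := (legendreC (n + 1) z - legendreC (n - 1) z)%C.

Lemma phiC_RtoC n x : phiC n (RtoC x) = RtoC (phi_LGL n x).
Proof. unfold phiC, phi_LGL. now rewrite !legendreC_RtoC, RtoC_minus. Qed.

(** This is P_n(1) = 1 read on the expansion at u = 1. It makes the coefficients of P_n a convex
    combination, and later identifies the square of the generating series of [cbin]. *)
Lemma cbin_conv n : sum_n (fun k => cbin k * cbin (n - k)) n = 1.
Proof.
apply RtoC_inj. rewrite RtoC_sum, <- (legendre_at_1 n), <- legendreC_RtoC.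
replace (RtoC 1) with ((1 + 1) / 2)%C by field.
rewrite legendreC_laurent by ring. unfold laurent.
apply Csum_ext. intros k _. rewrite !Cpow_1_l. ring.
Qed.

(** Here x = (u+1/u)/2 with u = x + i sqrt(1-x^2) on the unit circle, and the expansion has positive
    coefficients of sum 1: the triangle inequality is enough. *)
Lemma legendre_bound n x : -1 <= x <= 1 -> Rabs (legendre n x) <= 1.
Proof.
intros Hx. set (y := sqrt (1 - x ^ 2)).
assert (Hy : y * y = 1 - x ^ 2) by (apply sqrt_sqrt; nra).
assert (Hm : forall e, e * e = 1 -> Cmod (x, e * y) = 1).
{ intros e He. unfold Cmod. simpl fst; simpl snd.
  replace (x ^ 2 + (e * y) ^ 2) with 1 by nra. apply sqrt_1. }
set (p := (x, 1 * y) : C). set (s := (x, (-1) * y) : C).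
assert (Hps : (p * s)%C = 1%C) by (apply injective_projections; simpl; nra).
assert (Hx2 : RtoC x = ((p + s) / 2)%C)
  by (apply injective_projections; simpl; field).
rewrite <- Cmod_R, <- legendreC_RtoC, Hx2, legendreC_laurent by exact Hps.
unfold laurent. eapply Rle_trans; [apply Cmod_sum|].
rewrite <- (cbin_conv n). apply Rsum_le. intros k _.
rewrite !Cmod_mult, !Cmod_pow, Cmod_R.
unfold p, s. rewrite !Hm by lra. rewrite !pow1, !Rmult_1_r.
rewrite Rabs_pos_eq; [lra|]. pose proof (cbin_pos k). pose proof (cbin_pos (n - k)). nra.
Qed.

(** With n = m+1, this is minus the coefficient of u^(m-2k) in phi((u+1/u)/2): that monomial has
    index k in P_(n-1) and index k+1 in P_(n+1). *)
Definition phi_coef (m k : nat) : R :=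
  cbin k * cbin (m - k) - cbin (S k) * cbin (S m - k).

Lemma phi_coef_ge0 m k : (k <= m)%nat -> 0 <= phi_coef m k.
Proof.
intros Hk. unfold phi_coef. rewrite (Nat.sub_succ_l k m Hk).
pose proof (cbin_pos k). pose proof (cbin_pos (S k)). pose proof (cbin_S_le k).
pose proof (cbin_pos (m - k)). pose proof (cbin_pos (S (m - k))).
pose proof (cbin_S_le (m - k)). nra.
Qed.

(** In the Laurent expansion of [phi_LGL] only the two extreme coefficients are
    positive. *)
Lemma phiC_laurent m (p s : C) : (p * s = 1)%C ->
  phiC (S m) ((p + s) / 2)%C =
  (RtoC (cbin (S (S m))) * Cpow p (S (S m))
   - sum_n (fun k => RtoC (phi_coef m k) * (Cpow s (S k) * Cpow p (S m - k)))%C m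
   + RtoC (cbin (S (S m))) * Cpow s (S (S m)))%C.
Proof.
intros Hps. unfold phiC. replace (S m - 1)%nat with m by lia.
replace (S m + 1)%nat with (S (S m)) by lia.
rewrite !legendreC_laurent by exact Hps.
assert (E0 : laurent m p s = sum_n (fun k => RtoC (cbin k * cbin (m - k))
                          * (Cpow s (S k) * Cpow p (S m - k)))%C m).
{ unfold laurent. apply Csum_ext. intros k Hk.
  rewrite (Nat.sub_succ_l k m Hk). simpl Cpow.
  rewrite <- (Cmult_1_l (Cpow s k * _)), <- Hps. ring. }
rewrite E0. unfold laurent. rewrite Csum_S, Csum_shift, Nat.sub_diag, Nat.sub_0_r.
change (cbin 0) with 1. rewrite !Rmult_1_r, !Rmult_1_l.
set (S1 := sum_n _ m). set (S2 := sum_n _ m). set (S3 := sum_n _ m).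
assert (E : S1 = (S2 - S3)%C).
{ replace (S2 - S3)%C with (S2 + RtoC (-1) * S3)%C by ring.
  unfold S1, S2, S3. rewrite <- Csum_scal, <- Csum_plus. apply Csum_ext.
  intros k Hk. unfold phi_coef. rewrite RtoC_minus. rewrite (Nat.sub_succ (S m) k). ring. }
rewrite E. simpl Cpow. ring.
Qed.

(** At the vertex u = rho the expansion reads A - B + D with A, B, D nonnegative; elsewhere on |u| =
    rho the triangle inequality only gives A - B - D. The subtracted term is the difference 2D. *)
Definition phi_lower (rho : R) (n : nat) : R :=
  phi_LGL n ((rho + / rho) / 2) - 2 * cbin (S n) * / rho ^ (S n).

Lemma phiC_ge_phi_lower rho u n : 0 < rho -> (1 <= n)%nat -> Cmod u = rho ->
  phi_lower rho n <= Cmod (phiC n ((u + / u) / 2)%C).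
Proof.
intros Hr Hn Hu. destruct n as [|m]; [lia|]. clear Hn.
assert (Hu0 : u <> 0%C) by (apply Cmod_gt_0; lra).
assert (Hr0 : RtoC rho <> 0%C) by (apply RtoC_neq_0; lra).
rewrite phiC_laurent by (field; exact Hu0).
assert (E : RtoC (phi_LGL (S m) ((rho + / rho) / 2)) =
  RtoC (cbin (S (S m)) * rho ^ (S (S m))
   - sum_n (fun k => phi_coef m k * ((/ rho) ^ (S k) * rho ^ (S m - k))) m
   + cbin (S (S m)) * (/ rho) ^ (S (S m)))).
{ rewrite <- phiC_RtoC.
  replace (RtoC ((rho + / rho) / 2)) with ((RtoC rho + RtoC (/ rho)) / 2)%C
    by (rewrite <- RtoC_plus, <- RtoC_div by lra; reflexivity).
  rewrite phiC_laurent by (rewrite <- RtoC_mult; f_equal; field; lra).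
  rewrite RtoC_plus, RtoC_minus, RtoC_sum, !RtoC_mult, !RtoC_pow.
  apply (f_equal2 Cplus); [|reflexivity]. apply (f_equal2 Cminus); [reflexivity|].
  apply Csum_ext. intros k _. now rewrite !RtoC_mult, !RtoC_pow. }
apply RtoC_inj in E. unfold phi_lower. rewrite E.
set (A := (RtoC (cbin (S (S m))) * Cpow u (S (S m)))%C).
set (B := sum_n (fun k => RtoC (phi_coef m k) * (Cpow (/ u) (S k) * Cpow u (S m - k)))%C m : C).
set (D := (RtoC (cbin (S (S m))) * Cpow (/ u) (S (S m)))%C).
assert (Hc := cbin_pos (S (S m))).
assert (HA : Cmod A = cbin (S (S m)) * rho ^ (S (S m))).
{ unfold A. rewrite Cmod_mult, Cmod_pow, Cmod_R, Hu, Rabs_pos_eq; lra. }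
assert (HD : Cmod D = cbin (S (S m)) * (/ rho) ^ (S (S m))).
{ unfold D. rewrite Cmod_mult, Cmod_pow, Cmod_R, Cmod_inv, Hu, Rabs_pos_eq by (easy || lra). easy. }
assert (HB : Cmod B <= sum_n (fun k => phi_coef m k * ((/ rho) ^ (S k) * rho ^ (S m - k))) m).
{ unfold B. eapply Rle_trans; [apply Cmod_sum|]. apply Rsum_le. intros k Hk.
  rewrite !Cmod_mult, !Cmod_pow, Cmod_R, Cmod_inv, Hu by easy.
  rewrite Rabs_pos_eq by now apply phi_coef_ge0. lra. }
assert (T : Cmod A <= Cmod (A - B + D) + Cmod B + Cmod D).
{ replace A with ((A - B + D) + B + - D)%C at 1 by ring.
  eapply Rle_trans; [apply Cmod_triangle|]. rewrite Cmod_opp.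
  apply Rplus_le_compat_r, Cmod_triangle. }
rewrite pow_inv in *. set (w := sum_n _ m) in *. lra.
Qed.

(** Differentiability and the two classical relations share one induction: the derivative of P_(n+2)
    comes from differentiating Bonnet's recurrence, and the relations at n+1 follow from those at n
    by linear elimination. *)
Lemma legendre_ex_derive n :
  exists d0 d1 : R -> R,
  forall x, is_derive (legendre n) x (d0 x) /\ is_derive (legendre (S n)) x (d1 x) /\
    d1 x - x * d0 x = (INR n + 1) * legendre n x /\
    x * d1 x - d0 x = (INR n + 1) * legendre (S n) x.
Proof.
induction n as [|n [d0 [d1 H]]].
- exists (fun _ => 0), (fun _ => 1). intros x. simpl.
  split; [apply (is_derive_const 1 x)|]. split; [apply (is_derive_id x)|].
  split; ring.
- exists d1, (fun x => ((2 * INR n + 3) * (legendre (S n) x + x * d1 x)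
                        - (INR n + 1) * d0 x) / (INR n + 2)).
  intros x. destruct (H x) as (H0 & H1 & E1 & E2). clear H. pose proof (pos_INR n) as Hn.
  assert (ED : d0 x = x * d1 x - (INR n + 1) * legendre (S n) x) by lra.
  rewrite S_INR. split; [exact H1|]. split; [|split].
  + apply (is_derive_ext (fun x => ((2 * INR n + 3) * x * legendre (S n) x
       - (INR n + 1) * legendre n x) * / (INR n + 2))); [reflexivity|].
    generalize dependent (legendre n). generalize dependent (legendre (S n)).
    intros P1 H1 E2 ED P0 H0 E1.
    auto_derive; [split; [now exists (d1 x)|]; split; [now exists (d0 x)|easy]|].
    replace (Derive (fun x0 : R => P1 x0) x) with (d1 x) by (symmetry; now apply is_derive_unique).
    replace (Derive (fun x0 : R => P0 x0) x) with (d0 x) by (symmetry; now apply is_derive_unique). field. lra.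
  + rewrite ED. field. lra.
  + rewrite legendre_rec. rewrite ED in E1 |- *.
    assert (EP : (INR n + 1) * legendre n x =
      d1 x - x * (x * d1 x - (INR n + 1) * legendre (S n) x)) by lra.
    rewrite EP. field. lra.
Qed.

(** * Bounds on the interval *)

Lemma is_derive_legendre n x : is_derive (legendre n) x (Derive (legendre n) x).
Proof.
destruct (legendre_ex_derive n) as (d0 & d1 & H). destruct (H x) as (H0 & _).
apply Derive_correct. now exists (d0 x).
Qed.

Lemma legendre_derive_rel n x :
  Derive (legendre (S n)) x - x * Derive (legendre n) x = (INR n + 1) * legendre n x /\
  x * Derive (legendre (S n)) x - Derive (legendre n) x = (INR n + 1) * legendre (S n) x.
Proof.
destruct (legendre_ex_derive n) as (d0 & d1 & H). destruct (H x) as (H0 & H1 & E).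
now rewrite (is_derive_unique _ _ _ H0), (is_derive_unique _ _ _ H1).
Qed.

(** The sum of P_(n+1)' - x P_n' = (n+1) P_n and x P_n' - P_(n-1)' = n P_n. *)
Lemma is_derive_phi n x : (1 <= n)%nat ->
  is_derive (phi_LGL n) x ((2 * INR n + 1) * legendre n x).
Proof.
intros Hn. destruct n as [|m]; [lia|].
destruct (legendre_derive_rel m x) as [_ E1].
destruct (legendre_derive_rel (S m) x) as [E2 _].
replace ((2 * INR (S m) + 1) * legendre (S m) x)
  with (Derive (legendre (S (S m))) x - Derive (legendre m) x)
  by (rewrite S_INR in *; lra).
apply (is_derive_ext (fun t => legendre (S (S m)) t - legendre m t)).
- intros t. unfold phi_LGL. replace (S m + 1)%nat with (S (S m)) by lia.
  now replace (S m - 1)%nat with m by lia.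
- apply (is_derive_minus (legendre (S (S m))) (legendre m)); apply is_derive_legendre.
Qed.

(** As phi' = (2n+1) P_n, this is the second-order equation of phi, reached without differentiating
    twice. *)
Lemma phi_derive_legendre n x : (1 <= n)%nat ->
  INR n * (INR n + 1) * phi_LGL n x =
  - (2 * INR n + 1) * (1 - x ^ 2) * Derive (legendre n) x.
Proof.
intros Hn. destruct n as [|m]; [lia|]. clear Hn.
destruct (legendre_derive_rel m x) as [E1 E2].
unfold phi_LGL. replace (S m + 1)%nat with (S (S m)) by lia.
replace (S m - 1)%nat with m by lia. rewrite legendre_rec, S_INR.
pose proof (pos_INR m).
assert (EP : (INR m + 1) * legendre m x
  = (1 - x ^ 2) * Derive (legendre (S m)) x + x * ((INR m + 1) * legendre (S m) x))
  by (rewrite <- E1, <- E2; ring).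
transitivity ((2 * INR m + 3) * (INR m + 1)
  * (x * ((INR m + 1) * legendre (S m) x) - (INR m + 1) * legendre m x) / (INR m + 1)).
- field. lra.
- rewrite EP. field. lra.
Qed.

Definition sonin (n : nat) (x : R) : R :=
  phi_LGL n x ^ 2
  + (1 - x ^ 2) * ((2 * INR n + 1) * legendre n x) ^ 2 / (INR n * (INR n + 1)).

Lemma is_derive_sonin n x : (1 <= n)%nat ->
  is_derive (sonin n) x
    (- (2 * x * ((2 * INR n + 1) * legendre n x) ^ 2 / (INR n * (INR n + 1)))).
Proof.
intros Hn. pose proof (is_derive_phi n x Hn) as Dphi.
pose proof (is_derive_legendre n x) as DP. pose proof (phi_derive_legendre n x Hn) as E.
assert (Hn' : 1 <= INR n) by now apply (le_INR 1).
unfold sonin. set (d := Derive (legendre n) x) in *.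
generalize dependent (phi_LGL n). generalize dependent (legendre n). intros P d DP phi Dphi E.
auto_derive; [split; [now eexists; apply Dphi|]; split; [now exists d|easy]|].
replace (Derive (fun x0 : R => phi x0) x) with ((2 * INR n + 1) * P x)
  by (symmetry; now apply is_derive_unique).
replace (Derive (fun x0 : R => P x0) x) with d by (symmetry; now apply is_derive_unique).
replace (phi x) with (- (2 * INR n + 1) * (1 - x ^ 2) * d / (INR n * (INR n + 1)))
  by (rewrite <- E; field; lra).
field. lra.
Qed.

Lemma phi_sq_le_sonin_0 n x : (1 <= n)%nat -> -1 <= x <= 1 ->
  phi_LGL n x ^ 2 <= sonin n 0.
Proof.
intros Hn Hx. assert (Hn' : 1 <= INR n) by now apply (le_INR 1).
assert (H1 : phi_LGL n x ^ 2 <= sonin n x).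
{ unfold sonin. assert (0 <= (1 - x ^ 2) * ((2 * INR n + 1) * legendre n x) ^ 2 / (INR n * (INR n + 1))); [|lra].
  apply Rdiv_le_0_compat; [|nra]. apply Rmult_le_pos; [nra|apply pow2_ge_0]. }
destruct (MVT_gen (sonin n) 0 x (fun x => - (2 * x * ((2 * INR n + 1) * legendre n x) ^ 2 / (INR n * (INR n + 1)))))
  as (c & Hc & E).
- intros t _. now apply is_derive_sonin.
- intros t _. apply continuity_pt_filterlim.
  apply (ex_derive_continuous (sonin n)). eexists. now apply is_derive_sonin.
(* The mean value point c lies between 0 and x, hence has the sign of x, and the increment of
   [sonin] is a nonpositive multiple of c x. *)
- assert (Hcx : 0 <= c * x).
  { destruct (Rle_dec 0 x).
    - rewrite Rmin_left, Rmax_right in Hc by lra. nra.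
    - rewrite Rmin_right, Rmax_left in Hc by lra. nra. }
  assert (0 <= c * x * (((2 * INR n + 1) * legendre n c) ^ 2 / (INR n * (INR n + 1)))).
  { apply Rmult_le_pos; [easy|]. apply Rdiv_le_0_compat; [apply pow2_ge_0|nra]. }
  unfold Rdiv in *. lra.
Qed.

Lemma legendre_at_0 k :
  legendre (2 * k) 0 = (-1) ^ k * cbin k /\ legendre (2 * k + 1) 0 = 0.
Proof.
induction k as [|k [IH1 IH2]]; [simpl; split; ring|].
replace (2 * S k)%nat with (S (S (2 * k))) by lia.
replace (S (S (2 * k)) + 1)%nat with (S (S (S (2 * k)))) by lia.
replace (2 * k + 1)%nat with (S (2 * k)) in IH2 by lia.
assert (H2 : legendre (S (S (2 * k))) 0 = (-1) ^ S k * cbin (S k)).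
{ rewrite legendre_rec, IH1, IH2, cbin_S, mult_INR. simpl (INR 2). simpl pow.
  pose proof (pos_INR k). field. lra. }
split; [exact H2|].
rewrite legendre_rec, IH2. unfold Rdiv. ring.
Qed.

(** For k >= 1 the ratio of consecutive terms is (2k+1)^2/(4k(k+1)) > 1. Starting from index 1 it
    bounds [cbin] from below; going from k to 2k it bounds the loss when the index doubles. *)
Lemma cbin_scaled_incr j k : (j <= k)%nat ->
  INR j * cbin j ^ 2 <= INR k * cbin k ^ 2.
Proof.
induction 1 as [|k _ IH]; [apply Rle_refl|].
eapply Rle_trans; [exact IH|]. rewrite cbin_S, S_INR.
pose proof (pos_INR k). pose proof (cbin_pos k).
replace ((INR k + 1) * (cbin k * ((2 * INR k + 1) / (2 * INR k + 2))) ^ 2)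
  with (cbin k ^ 2 * ((2 * INR k + 1) ^ 2 / (4 * (INR k + 1)))) by (field; lra).
rewrite (Rmult_comm (INR k)). apply Rmult_le_compat_l; [apply pow2_ge_0|].
apply Rle_div_r; nra.
Qed.

Lemma cbin_lower n : (1 <= n)%nat -> / (2 * sqrt (INR n)) <= cbin n.
Proof.
intros Hn. pose proof (cbin_scaled_incr 1 n Hn) as H. simpl in H.
assert (Hn' : 1 <= INR n) by now apply (le_INR 1).
pose proof (sqrt_lt_R0 (INR n) ltac:(lra)) as Hs.
pose proof (sqrt_sqrt (INR n) ltac:(lra)) as Hss. pose proof (cbin_pos n).
apply Rmult_le_reg_r with (2 * sqrt (INR n)); [lra|].
rewrite Rinv_l by lra. apply Rsqr_incr_0_var; [|nra]. unfold Rsqr. nra.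
Qed.

Lemma cbin_half k n : (k <= n <= 2 * k)%nat -> cbin k ^ 2 <= 2 * cbin n ^ 2.
Proof.
intros [Hkn Hn].
assert (H : cbin k ^ 2 <= 2 * cbin (2 * k) ^ 2).
{ destruct k as [|k]; [simpl; lra|].
  pose proof (cbin_scaled_incr (S k) (2 * S k) ltac:(lia)) as H.
  rewrite mult_INR in H. change (INR 2) with 2 in H.
  pose proof (lt_0_INR (S k) ltac:(lia)). nra. }
pose proof (cbin_le n (2 * k) Hn). pose proof (cbin_pos (2 * k)). nra.
Qed.

(** One of the two terms vanishes at 0. For n = 2k, phi(0) = 0 and |P_n(0)| = g_k; for n = 2k+1,
    P_n(0) = 0 and |phi(0)| = g_(k+1) (2n+1)/n. Passing from an index near n/2 to n by [cbin_half]
    costs a factor 2 on squares: this is the sqrt 2 of the theorem. The index n is wanted because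
    the growth on the ellipse is measured by g_n rho^n. *)
Lemma sonin_0_le n : (1 <= n)%nat ->
  sonin n 0 <= 2 * (cbin n * (2 * INR n + 1) / INR n) ^ 2.
Proof.
intros Hn. assert (Hn' : 1 <= INR n) by now apply (le_INR 1).
assert (Hpow : forall k c, ((-1) ^ k * c) ^ 2 = c ^ 2).
{ intros k c. rewrite Rpow_mult_distr, <- pow_mult, Nat.mul_comm, pow_1_even. ring. }
destruct (Nat.Even_or_Odd n) as [[k Ek]|[k Ek]].
- destruct k as [|k]; [lia|].
  assert (Ephi : phi_LGL n 0 = 0).
  { unfold phi_LGL. replace (n + 1)%nat with (2 * S k + 1)%nat by lia.
    replace (n - 1)%nat with (2 * k + 1)%nat by lia.
    rewrite !(proj2 (legendre_at_0 _)). ring. }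
  unfold sonin. rewrite Ephi, Rpow_mult_distr.
  replace (legendre n 0) with ((-1) ^ (S k) * cbin (S k))
    by (rewrite Ek; symmetry; apply legendre_at_0).
  rewrite Hpow. pose proof (cbin_half (S k) n ltac:(lia)) as Hc.
  replace (2 * (cbin n * (2 * INR n + 1) / INR n) ^ 2)
    with ((2 * cbin n ^ 2) * ((2 * INR n + 1) ^ 2 / (INR n * INR n))) by (field; lra).
  replace (0 ^ 2 + (1 - 0 ^ 2) * ((2 * INR n + 1) ^ 2 * cbin (S k) ^ 2) / (INR n * (INR n + 1)))
    with (cbin (S k) ^ 2 * ((2 * INR n + 1) ^ 2 / (INR n * (INR n + 1)))) by (field; lra).
  apply Rmult_le_compat; [apply pow2_ge_0| |exact Hc|].
  + apply Rdiv_le_0_compat; [apply pow2_ge_0|nra].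
  + unfold Rdiv. apply Rmult_le_compat_l; [apply pow2_ge_0|]. apply Rinv_le_contravar; nra.
- assert (EP : legendre n 0 = 0) by (rewrite Ek; apply legendre_at_0).
  assert (En : INR n = 2 * INR k + 1).
  { rewrite Ek, plus_INR, mult_INR. simpl. ring. }
  pose proof (pos_INR k).
  assert (Ephi : phi_LGL n 0 = (-1) ^ (S k) * (cbin (S k) * (2 * INR n + 1) / INR n)).
  { unfold phi_LGL. replace (n + 1)%nat with (2 * S k)%nat by lia.
    replace (n - 1)%nat with (2 * k)%nat by lia.
    rewrite !(proj1 (legendre_at_0 _)), cbin_S, En. simpl pow. field. lra. }
  unfold sonin. rewrite EP, Ephi, Hpow.
  pose proof (cbin_half (S k) (2 * S k) ltac:(lia)) as Hc.
  pose proof (cbin_le n (2 * S k) ltac:(lia)) as Hc2.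
  pose proof (cbin_pos (2 * S k)).
  replace (2 * (cbin n * (2 * INR n + 1) / INR n) ^ 2)
    with ((2 * cbin n ^ 2) * ((2 * INR n + 1) / INR n) ^ 2) by (field; lra).
  replace ((cbin (S k) * (2 * INR n + 1) / INR n) ^ 2 +
    (1 - 0 ^ 2) * ((2 * INR n + 1) * 0) ^ 2 / (INR n * (INR n + 1)))
    with (cbin (S k) ^ 2 * ((2 * INR n + 1) / INR n) ^ 2) by (field; lra).
  apply Rmult_le_compat_r; [apply pow2_ge_0|]. nra.
Qed.

Lemma phi_bound n x : (1 <= n)%nat -> -1 <= x <= 1 ->
  Rabs (phi_LGL n x) <= sqrt 2 * (cbin n * (2 * INR n + 1) / INR n).
Proof.
intros Hn Hx. assert (Hn' : 1 <= INR n) by now apply (le_INR 1).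
pose proof (cbin_pos n).
assert (0 <= cbin n * (2 * INR n + 1) / INR n) by (apply Rdiv_le_0_compat; nra).
apply Rsqr_incr_0_var; [|apply Rmult_le_pos; [apply sqrt_pos|easy]].
rewrite <- Rsqr_abs, !Rsqr_pow2, Rpow_mult_distr, pow2_sqrt by lra.
eapply Rle_trans; [now apply phi_sq_le_sonin_0|]. now apply sonin_0_le.
Qed.

(** By (k+2)(P_(k+2) - P_(k+1)) = (2k+3)(t-1) P_(k+1) + (k+1)(P_(k+1) - P_k). *)
Lemma legendre_incr_gt1 t : 1 < t ->
  forall k, 0 < legendre k t /\ legendre k t < legendre (S k) t.
Proof.
intros Ht. induction k as [|k [IH1 IH2]]; [simpl; lra|].
split; [lra|]. rewrite legendre_rec. pose proof (pos_INR k).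
apply Rlt_div_r; [lra|].
assert (0 < (2 * INR k + 3) * legendre (S k) t * (t - 1)).
{ apply Rmult_lt_0_compat; nra. }
nra.
Qed.

Lemma phi_pos_gt1 n t : (1 <= n)%nat -> 1 < t -> 0 < phi_LGL n t.
Proof.
intros Hn Ht. unfold phi_LGL. destruct n as [|m]; [lia|].
replace (S m + 1)%nat with (S (S m)) by lia. replace (S m - 1)%nat with m by lia.
pose proof (legendre_incr_gt1 t Ht m). pose proof (legendre_incr_gt1 t Ht (S m)). lra.
Qed.

Lemma legendre_opp k t : legendre k (- t) = (-1) ^ k * legendre k t.
Proof.
induction k as [| |k IH1 IH2] using pair_ind; [simpl; ring|simpl; ring|].
rewrite !legendre_rec, IH1, IH2. simpl pow. pose proof (pos_INR k). field. lra.
Qed.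

(** [is_LGL_points] says only that the nodes are the real zeros of phi. Their location, on which
    every distance to the ellipse depends, comes from positivity of phi beyond 1 and from parity. *)
Lemma phi_zero_bound n t : (1 <= n)%nat -> phi_LGL n t = 0 -> -1 <= t <= 1.
Proof.
intros Hn H0. split; apply Rnot_lt_le; intros Ht.
- pose proof (phi_pos_gt1 n (- t) Hn ltac:(lra)) as Hp. revert H0 Hp.
  unfold phi_LGL. rewrite !legendre_opp. destruct n as [|m]; [lia|].
  replace (S m + 1)%nat with (S (S m)) by lia. replace (S m - 1)%nat with m by lia.
  simpl pow. intros E. replace (-1 * (-1 * (-1) ^ m) * legendre (S (S m)) t)
    with ((-1) ^ m * legendre (S (S m)) t) by ring.
  rewrite <- Rmult_minus_distr_l, E. lra.
- pose proof (phi_pos_gt1 n t Hn Ht). lra.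
Qed.

(** * Growth on the ellipse *)

Lemma legendre_joukowski n rho : 0 < rho ->
  legendre n ((rho + / rho) / 2) =
  rho ^ n * sum_n (fun k => cbin k * cbin (n - k) * (/ rho ^ 2) ^ k) n.
Proof.
intros Hr. apply RtoC_inj. rewrite <- legendreC_RtoC.
replace (RtoC ((rho + / rho) / 2)) with ((RtoC rho + RtoC (/ rho)) / 2)%C
    by (rewrite <- RtoC_plus, <- RtoC_div by lra; reflexivity).
rewrite legendreC_laurent by (rewrite <- RtoC_mult; f_equal; field; lra).
rewrite RtoC_mult, RtoC_sum, <- Csum_scal. apply Csum_ext. intros k Hk.
rewrite <- !RtoC_pow, <- !RtoC_mult. f_equal.
replace (rho ^ n) with (rho ^ k * rho ^ (n - k)) by (rewrite <- pow_add; f_equal; lia).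
replace ((/ rho) ^ k) with (rho ^ k * (/ rho ^ 2) ^ k); [ring|].
rewrite <- Rpow_mult_distr. f_equal. field. lra.
Qed.

(** Weaker than the true growth, but free of square roots: it gives the rational bound g_(n-k)/g_n
    <= (n+1)/(n-k+1). *)
Lemma cbin_succ_scaled_incr j k : (j <= k)%nat ->
  (INR j + 1) * cbin j <= (INR k + 1) * cbin k.
Proof.
induction 1 as [|k _ IH]; [apply Rle_refl|].
eapply Rle_trans; [exact IH|]. rewrite cbin_S, S_INR.
pose proof (pos_INR k). pose proof (cbin_pos k).
replace ((INR k + 1 + 1) * (cbin k * ((2 * INR k + 1) / (2 * INR k + 2))))
  with (cbin k * ((INR k + 2) * (2 * INR k + 1) / (2 * INR k + 2))) by (field; lra).
rewrite (Rmult_comm (INR k + 1)). apply Rmult_le_compat_l; [lra|].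
apply Rle_div_r; nra.
Qed.

(** The quotient g_(n-k)/g_n exceeds 1 by at most k/(n-k+1), and n+1 <= (k+1)(n-k+1) turns this into
    k(k+1)/(n+1). The error is O(1/n) with a weight quadratic in k, hence summable against q^k; this
    takes the place of dominated convergence. *)
Lemma cbin_ratio_bounds n k : (k <= n)%nat ->
  cbin k <= cbin k * cbin (n - k) / cbin n
  <= cbin k + (INR k + 1) * (INR k + 2) / (INR n + 1).
Proof.
intros Hk. pose proof (cbin_pos n) as Hn. pose proof (cbin_pos k) as Hk0.
pose proof (cbin_le (n - k) n ltac:(lia)) as H1.
pose proof (cbin_succ_scaled_incr (n - k) n ltac:(lia)) as H2.
assert (HI : INR n = INR k + INR (n - k)) by (rewrite <- plus_INR; apply f_equal; lia).
pose proof (pos_INR k) as Pk. pose proof (pos_INR (n - k)) as Pnk.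
set (u := cbin (n - k) / cbin n).
assert (Hu1 : 1 <= u) by (apply Rle_div_r; lra).
assert (Hu2 : (INR (n - k) + 1) * u <= INR n + 1).
{ unfold u. apply Rmult_le_reg_r with (cbin n); [easy|].
  replace ((INR (n - k) + 1) * (cbin (n - k) / cbin n) * cbin n)
    with ((INR (n - k) + 1) * cbin (n - k)) by (field; lra). exact H2. }
replace (cbin k * cbin (n - k) / cbin n) with (cbin k * u) by (unfold u; field; lra).
split; [nra|].
pose proof (cbin_le_1 k) as Hk1.
assert (Hv : (u - 1) * (INR n + 1) <= INR k * (INR k + 1)).
{ set (d := INR (n - k)) in *. rewrite HI in *.
  assert ((d + 1) * (u - 1) <= INR k) by lra.
  assert ((INR k + d + 1) <= (INR k + 1) * (d + 1)) by nra.
  apply Rle_trans with ((u - 1) * ((INR k + 1) * (d + 1))); [nra|]. nra. }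
assert (Hw : u - 1 <= INR k * (INR k + 1) / (INR n + 1)) by (apply Rle_div_r; lra).
assert (Hz : INR k * (INR k + 1) / (INR n + 1) <= (INR k + 1) * (INR k + 2) / (INR n + 1)).
{ apply Rmult_le_compat_r; [|nra]. apply Rlt_le, Rinv_0_lt_compat. lra. }
nra.
Qed.

Lemma is_lim_seq_inv_INR_S : is_lim_seq (fun k => / (INR k + 1)) 0.
Proof.
apply (is_lim_seq_inv _ p_infty); [|easy].
apply (is_lim_seq_ext (fun k => INR (S k))); [intros k; apply S_INR|].
apply is_lim_seq_incr_1 with (u := INR). apply is_lim_seq_INR.
Qed.

(** The weight (k+1)(k+2) never vanishes, as the ratio test demands, and its consecutive quotients
    are 1 + 2/(k+1). *)
Lemma quadratic_geom_bounded q : 0 < q < 1 ->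
  exists B, forall n, sum_n (fun k => (INR k + 1) * (INR k + 2) * q ^ k) n <= B.
Proof.
intros Hq. set (a := fun k => (INR k + 1) * (INR k + 2) * q ^ k).
assert (Ha : forall k, 0 < a k).
{ intros k. unfold a. pose proof (pos_INR k). pose proof (pow_lt q k ltac:(lra)).
  apply Rmult_lt_0_compat; nra. }
assert (Hex : ex_series (fun k => Rabs (a k))).
{ apply ex_series_DAlembert with q; [lra|intros k; specialize (Ha k); lra|].
  apply is_lim_seq_ext with (fun k => q * (1 + 2 * / (INR k + 1))).
  - intros k. rewrite Rabs_pos_eq.
    + unfold a. rewrite S_INR. simpl pow. pose proof (pos_INR k).
      pose proof (pow_lt q k ltac:(lra)). field. repeat split; lra.
    + apply Rdiv_le_0_compat; [apply Rlt_le, Ha|apply Ha].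
  - replace (Finite q) with (Rbar_mult q (Finite (1 + 2 * 0))) by (simpl; f_equal; ring).
    apply is_lim_seq_scal_l. apply is_lim_seq_plus'; [apply is_lim_seq_const|].
    apply (is_lim_seq_scal_l (fun k => / (INR k + 1)) 2 0).
    exact is_lim_seq_inv_INR_S. }
exists (Series (fun k => Rabs (a k))). intros n.
rewrite sum_n_Reals.
apply Rle_trans with (sum_f_R0 (fun k => Rabs (a k)) n).
- apply sum_Rle. intros k _. apply Rle_abs.
- apply sum_incr; [|intros k; apply Rabs_pos].
  apply is_series_Reals. now apply Series_correct.
Qed.

(** By [cbin_conv] the Cauchy square of the series is the geometric series, so its sum squares to
    1/(1-q); the terms are nonnegative, which selects the root. *)
Lemma cbin_series q : 0 <= q < 1 ->
  is_series (fun k => cbin k * q ^ k) (/ sqrt (1 - q)).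
Proof.
intros Hq. set (a := fun k => cbin k * q ^ k).
assert (Ha : forall k, 0 <= a k <= q ^ k).
{ intros k. unfold a. pose proof (cbin_pos k). pose proof (cbin_le_1 k).
  pose proof (pow_le q k ltac:(lra)). nra. }
assert (Hex : ex_series (fun k => Rabs (a k))).
{ apply (ex_series_le (V := R_CompleteNormedModule) (fun k => Rabs (a k)) (fun k => q ^ k)).
  - intros k. change (Rabs (Rabs (a k)) <= q ^ k).
    rewrite Rabs_Rabsolu, Rabs_pos_eq; apply Ha.
  - apply ex_series_geom. rewrite Rabs_pos_eq; lra. }
assert (Hs : is_series a (Series a)) by now apply Series_correct, ex_series_Rabs.
assert (Hm := is_series_mult _ _ _ _ Hs Hs Hex Hex).
assert (Hg : is_series (fun n => q ^ n) (Series a * Series a)).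
{ eapply is_series_ext; [|exact Hm]. intros n.
  transitivity (q ^ n * sum_n (fun k => cbin k * cbin (n - k)) n).
  2:{ rewrite cbin_conv. apply Rmult_1_r. }
  rewrite sum_n_Reals, scal_sum. apply sum_eq. intros k Hk. unfold a.
  replace (q ^ n) with (q ^ k * q ^ (n - k)) by (rewrite <- pow_add; f_equal; lia). ring. }
assert (Hg' : is_series (fun n => q ^ n) (/ (1 - q)))
  by (apply is_series_geom; rewrite Rabs_pos_eq; lra).
assert (E : Series a * Series a = / (1 - q))
  by (rewrite <- (is_series_unique _ _ Hg); now apply is_series_unique).
assert (H0 : 0 <= Series a).
{ apply Rle_trans with (sum_f_R0 a 0); [apply (Ha 0%nat)|].
  apply sum_incr; [|intros k; apply Ha]. now apply is_series_Reals. }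
replace (/ sqrt (1 - q)) with (Series a); [exact Hs|].
rewrite <- sqrt_inv, <- E. symmetry. now apply sqrt_square.
Qed.

Lemma legendre_joukowski_asymp rho : 1 < rho ->
  is_lim_seq (fun n => legendre n ((rho + / rho) / 2) / (cbin n * rho ^ n))
    (/ sqrt (1 - / rho ^ 2)).
Proof.
intros Hr. set (q := / rho ^ 2).
assert (Hq : 0 < q < 1).
{ unfold q. split; [apply Rinv_0_lt_compat; nra|].
  rewrite <- Rinv_1. apply Rinv_lt_contravar; nra. }
destruct (quadratic_geom_bounded q Hq) as [B HB].
assert (Hs := cbin_series q ltac:(lra)).
set (S := fun n => sum_n (fun k => cbin k * q ^ k) n).
assert (E : forall n, legendre n ((rho + / rho) / 2) / (cbin n * rho ^ n) =
  sum_n (fun k => cbin k * cbin (n - k) / cbin n * q ^ k) n).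
{ intros n. rewrite legendre_joukowski by lra. fold q.
  pose proof (cbin_pos n). pose proof (pow_lt rho n ltac:(lra)).
  transitivity (/ cbin n * sum_n (fun k => cbin k * cbin (n - k) * q ^ k) n).
  - field. lra.
  - rewrite <- (sum_n_mult_l (/ cbin n : R_Ring)). apply sum_n_ext. intros k.
    change (/ cbin n * (cbin k * cbin (n - k) * q ^ k)
      = cbin k * cbin (n - k) / cbin n * q ^ k). field. lra. }
apply is_lim_seq_ext with (1 := fun n => eq_sym (E n)).
(* Squeeze between the partial sums of the generating series and the same sums plus the O(1/n)
   error. *)
apply is_lim_seq_le_le with S (fun n => S n + B * / (INR n + 1)).
- intros n. pose proof (pos_INR n). split.
  + apply Rsum_le. intros k Hk. apply Rmult_le_compat_r; [apply pow_le; lra|].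
    now apply cbin_ratio_bounds.
  + apply Rle_trans with (sum_n (fun k => cbin k * q ^ k
      + / (INR n + 1) * ((INR k + 1) * (INR k + 2) * q ^ k)) n).
    * apply Rsum_le. intros k Hk. destruct (cbin_ratio_bounds n k Hk) as [_ Hb].
      pose proof (pow_lt q k ltac:(lra)) as Hqk.
      apply Rmult_le_compat_r with (r := q ^ k) in Hb; [|lra]. unfold Rdiv in *. lra.
    * assert (Ep : sum_n (fun k => cbin k * q ^ k
        + / (INR n + 1) * ((INR k + 1) * (INR k + 2) * q ^ k)) n
        = S n + / (INR n + 1) * sum_n (fun k => (INR k + 1) * (INR k + 2) * q ^ k) n).
      { rewrite <- (sum_n_mult_l (/ (INR n + 1) : R_Ring)).
        exact (sum_n_plus (G := R_AbelianMonoid) _ _ n). }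
      rewrite Ep. apply Rplus_le_compat_l. rewrite Rmult_comm.
      apply Rmult_le_compat_r; [|apply HB].
      apply Rlt_le, Rinv_0_lt_compat. lra.
- exact Hs.
- replace (Finite (/ sqrt (1 - q))) with (Finite (/ sqrt (1 - q) + B * 0)) by (f_equal; ring).
  apply is_lim_seq_plus'; [exact Hs|].
  apply (is_lim_seq_scal_l (fun k => / (INR k + 1)) B 0).
  exact is_lim_seq_inv_INR_S.
Qed.

Lemma cbin_ratio_lim : is_lim_seq (fun n => cbin (S n) / cbin n) 1.
Proof.
apply is_lim_seq_ext with (fun n => 1 + - / 2 * / (INR n + 1)).
- intros n. rewrite cbin_S. pose proof (cbin_pos n). pose proof (pos_INR n). field. lra.
- replace (Finite 1) with (Finite (1 + - / 2 * 0)) by (f_equal; ring).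
  apply is_lim_seq_plus'; [apply is_lim_seq_const|].
  apply (is_lim_seq_scal_l (fun k => / (INR k + 1)) (- / 2) 0).
  exact is_lim_seq_inv_INR_S.
Qed.

(** In units of g_n rho^n, P_(n+1) tends to rho G and P_(n-1) to G/rho with G = rho/sqrt(rho^2-1),
    and (rho - 1/rho) G = sqrt(rho^2-1); the correction in [phi_lower] is O(rho^(-2n)). Shifting the
    sequence by one avoids the truncated n-1 at n = 0. *)
Lemma phi_lower_asymp rho : 1 < rho ->
  is_lim_seq (fun n => phi_lower rho n / (cbin n * rho ^ n)) (sqrt (rho ^ 2 - 1)).
Proof.
intros Hr. apply is_lim_seq_incr_1.
pose proof (legendre_joukowski_asymp rho Hr) as HA.
set (A := fun n => legendre n ((rho + / rho) / 2) / (cbin n * rho ^ n)) in *.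
set (G := / sqrt (1 - / rho ^ 2)) in *.
set (r := fun n => cbin (S n) / cbin n).
assert (Hr1 : is_lim_seq r 1) by exact cbin_ratio_lim.
assert (Hq : 0 < / rho ^ 2 < 1).
{ split; [apply Rinv_0_lt_compat; nra|].
  rewrite <- Rinv_1. apply Rinv_lt_contravar; nra. }
apply is_lim_seq_ext with (fun n => rho * (A (S (S n)) * r (S n))
  + (- / rho) * (A n * / r n) + (- 2 * / rho) * (r (S n) * ((/ rho ^ 2) ^ (S n)))).
- intros m. unfold A, r, phi_lower, phi_LGL.
  replace (S m + 1)%nat with (S (S m)) by lia. replace (S m - 1)%nat with m by lia.
  pose proof (cbin_pos m). pose proof (cbin_pos (S m)). pose proof (cbin_pos (S (S m))).
  rewrite pow_inv, <- pow_mult, (Nat.mul_comm 2), pow_mult. simpl pow.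
  pose proof (pow_lt rho m ltac:(lra)). field. repeat split; lra.
- assert (Hlim : is_lim_seq (fun n => rho * (A (S (S n)) * r (S n))
    + (- / rho) * (A n * / r n) + (- 2 * / rho) * (r (S n) * ((/ rho ^ 2) ^ (S n))))
    (rho * (G * 1) + (- / rho) * (G * / 1) + (- 2 * / rho) * (1 * 0))).
  { assert (H1S : is_lim_seq (fun n => r (S n)) 1) by exact (proj1 (is_lim_seq_incr_1 r 1) Hr1).
    apply is_lim_seq_plus'; [apply is_lim_seq_plus'|].
    - apply (is_lim_seq_scal_l (fun n => A (S (S n)) * r (S n)) rho (G * 1)).
      apply is_lim_seq_mult'; [|exact H1S].
      apply (proj1 (is_lim_seq_incr_1 (fun n => A (S n)) G)).
      exact (proj1 (is_lim_seq_incr_1 A G) HA).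
    - apply (is_lim_seq_scal_l (fun n => A n * / r n) (- / rho) (G * / 1)).
      apply is_lim_seq_mult'; [exact HA|].
      apply (is_lim_seq_inv r 1); [exact Hr1|]. intros E; injection E; lra.
    - apply (is_lim_seq_scal_l (fun n => r (S n) * (/ rho ^ 2) ^ (S n)) _ (1 * 0)).
      apply is_lim_seq_mult'; [exact H1S|].
      apply (proj1 (is_lim_seq_incr_1 (fun n => (/ rho ^ 2) ^ n) 0)).
      apply is_lim_seq_geom. rewrite Rabs_pos_eq; lra. }
  replace (sqrt (rho ^ 2 - 1)) with
    (rho * (G * 1) + (- / rho) * (G * / 1) + (- 2 * / rho) * (1 * 0)); [exact Hlim|].
  assert (Es : sqrt (1 - / rho ^ 2) = sqrt (rho ^ 2 - 1) / rho).
  { replace (1 - / rho ^ 2) with ((rho ^ 2 - 1) / rho ^ 2) by (field; lra).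
    rewrite sqrt_div by nra. now rewrite sqrt_pow2 by lra. }
  unfold G. rewrite Es. set (s := sqrt (rho ^ 2 - 1)).
  assert (Hs : 0 < s) by (apply sqrt_lt_R0; nra).
  assert (Hss : s * s = rho ^ 2 - 1) by (apply sqrt_sqrt; nra).
  transitivity ((rho ^ 2 - 1) / s); [field; lra|]. rewrite <- Hss. field. lra.
Qed.

(** * Strict complex differentiability *)

(** Differentiability with both points free. It follows directly from a power series and implies,
    through [strict_derive_close], the continuity of the derivative needed under the integral
    sign. *)
Definition strict_derive (f : C -> C) (z0 l : C) : Prop :=
  forall eps, 0 < eps -> exists delta, 0 < delta /\
    forall z1 z2, Cmod (z1 - z0) < delta -> Cmod (z2 - z0) < delta ->
      Cmod (f z1 - f z2 - l * (z1 - z2)) <= eps * Cmod (z1 - z2).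

(** The sharp factor k+1 is replaced by 2^k: the majorant stays geometric and the loss is absorbed
    by shrinking the disc. *)
Lemma Cpow_diff_bound r h1 h2 k : 0 <= r -> Cmod h1 <= r -> Cmod h2 <= r ->
  Cmod (Cpow h1 (S k) - Cpow h2 (S k)) <= (2 * r) ^ k * Cmod (h1 - h2).
Proof.
intros Hr H1 H2. induction k as [|k IH].
- simpl. rewrite !Cmult_1_r. lra.
- replace (Cpow h1 (S (S k)) - Cpow h2 (S (S k)))%C
    with (h1 * (Cpow h1 (S k) - Cpow h2 (S k)) + (h1 - h2) * Cpow h2 (S k))%C
    by (simpl Cpow; ring).
  eapply Rle_trans; [apply Cmod_triangle|]. rewrite !Cmod_mult, Cmod_pow.
  pose proof (Cmod_ge_0 h1). pose proof (Cmod_ge_0 h2).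
  pose proof (Cmod_ge_0 (h1 - h2)).
  assert (Ha : Cmod h1 * Cmod (Cpow h1 (S k) - Cpow h2 (S k))
    <= r * ((2 * r) ^ k * Cmod (h1 - h2)))
    by (apply Rmult_le_compat; try assumption; apply Cmod_ge_0).
  assert (Hb : Cmod h2 ^ S k <= r * (2 * r) ^ k).
  { apply Rle_trans with (r ^ S k); [apply pow_incr; lra|]. simpl pow.
    apply Rmult_le_compat_l; [easy|]. apply pow_incr. lra. }
  simpl pow in *. nra.
Qed.

Lemma pseries_Cmod_lim (a : nat -> C) (h l : C) :
  @is_pseries C_AbsRing C_NormedModule a h l ->
  forall eps, 0 < eps -> exists N, forall n, (N <= n)%nat ->
    Cmod (sum_n (fun k => a k * Cpow h k)%C n - l) < eps.
Proof.
intros H eps Heps. unfold is_pseries, is_series in H.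
destruct (H (fun z => Cmod (z - l) < eps)) as [N HN].
- destruct (locally_ball_norm (K := C_AbsRing) (V := C_NormedModule) l (mkposreal eps Heps)) as [d Hd].
  exists d. intros y Hy. specialize (Hd y Hy). unfold ball_norm in Hd.
  exact Hd.
- exists N. intros n Hn. specialize (HN n Hn).
  match type of HN with Cmod (?S - l) < _ => replace (sum_n (fun k => (a k * Cpow h k)%C) n) with S; [exact HN|] end.
  apply Csum_ext. intros k _.
  change (pow_n h k * a k = a k * Cpow h k)%C. apply Cmult_comm.
Qed.

Lemma pseries_terms_bounded (a : nat -> C) (h l : C) :
  @is_pseries C_AbsRing C_NormedModule a h l ->
  exists B, 0 < B /\ forall k, Cmod (a k) * Cmod h ^ k <= B.
Proof.
intros H. destruct (pseries_Cmod_lim a h l H 1 Rlt_0_1) as [N HN].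
set (t := fun k => (a k * Cpow h k)%C).
assert (Ht : forall k, Cmod (a k) * Cmod h ^ k = Cmod (t k))
  by (intros k; unfold t; now rewrite Cmod_mult, Cmod_pow).
exists (2 + sum_n (fun k => Cmod (t k)) N).
assert (Hpos : forall n, 0 <= sum_n (fun k => Cmod (t k)) n).
{ induction n as [|n IH]; [rewrite sum_O; apply Cmod_ge_0|].
  rewrite Rsum_S. pose proof (Cmod_ge_0 (t (S n))). lra. }
split; [pose proof (Hpos N); lra|]. intros k. rewrite Ht.
destruct (Nat.le_gt_cases k N) as [Hk|Hk].
- assert (Hs : forall n, (k <= n)%nat -> Cmod (t k) <= sum_n (fun k => Cmod (t k)) n).
  { induction n as [|n IH]; intros Hn.
    - replace k with 0%nat by lia. rewrite sum_O. lra.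
    - rewrite Rsum_S. destruct (Nat.eq_dec k (S n)) as [->|Hne].
      + pose proof (Hpos n). lra.
      + pose proof (IH ltac:(lia)). pose proof (Cmod_ge_0 (t (S n))). lra. }
  specialize (Hs N Hk). lra.
- destruct k as [|k]; [lia|].
  pose proof (HN k ltac:(lia)) as H1. pose proof (HN (S k) ltac:(lia)) as H2.
  change (Cmod (sum_n t k - l) < 1) in H1. change (Cmod (sum_n t (S k) - l) < 1) in H2.
  rewrite Csum_S in H2.
  set (S0 := sum_n t k : C) in *.
  replace (t (S k)) with ((S0 + t (S k) - l) + - (S0 - l))%C by ring.
  eapply Rle_trans; [apply Cmod_triangle|]. rewrite Cmod_opp.
  pose proof (Hpos N). lra.
Qed.

(** The terms a_k w^k are bounded by B at w = r/2. On the disc of radius eta w the terms of order at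
    least 2 then have difference quotients dominated by B/w times a geometric series of ratio x = 2
    eta, of sum at most 2x. *)
Lemma analytic_strict_derive f z0 : analytic_at f z0 -> exists l, strict_derive f z0 l.
Proof.
intros (a & r & Hr & Hf).
set (w := r / 2). assert (Hw : 0 < w) by (unfold w; lra).
destruct (pseries_terms_bounded a (RtoC w) (f (z0 + RtoC w)%C)) as (B & HB0 & HB).
{ replace (RtoC w) with ((z0 + RtoC w) - z0)%C at 1 by ring. apply Hf.
  replace (z0 + RtoC w - z0)%C with (RtoC w) by ring.
  rewrite Cmod_R, Rabs_pos_eq by lra. unfold w. lra. }
rewrite Cmod_R, Rabs_pos_eq in HB by lra.
exists (a 1%nat). intros eps Heps.
(* The first bound gives x <= 1/2, the second makes 2x B/w = 4 eta B/w at most eps. *)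
set (eta := Rmin (/ 4) (eps * w / (4 * B))).
assert (He0 : 0 < eta).
{ apply Rmin_pos; [lra|]. apply Rdiv_lt_0_compat; nra. }
assert (He1 : eta <= / 4) by apply Rmin_l.
assert (He2 : B / w * (4 * eta) <= eps).
{ apply Rle_trans with (B / w * (4 * (eps * w / (4 * B)))); [|right; field; lra].
  apply Rmult_le_compat_l; [apply Rdiv_le_0_compat; lra|].
  apply Rmult_le_compat_l; [lra|apply Rmin_r]. }
exists (eta * w). split; [nra|]. intros z1 z2 Hz1 Hz2.
assert (Hin : eta * w < r) by (unfold w in *; nra).
pose proof (pseries_Cmod_lim a _ _ (Hf z1 ltac:(lra))) as L1.
pose proof (pseries_Cmod_lim a _ _ (Hf z2 ltac:(lra))) as L2.
set (h1 := (z1 - z0)%C) in *. set (h2 := (z2 - z0)%C) in *.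
replace (z1 - z2)%C with (h1 - h2)%C by (unfold h1, h2; ring).
set (x := 2 * eta). assert (Hx : 0 < x <= / 2) by (unfold x; lra).
set (d := Cmod (h1 - h2)). assert (Hd : 0 <= d) by apply Cmod_ge_0.
(* The bound telescopes: for x <= 1/2, the new contribution x^(n+1) is at most 2x^(n+1) -
   2x^(n+2). *)
assert (Est : forall n,
  Cmod (sum_n (fun k => a k * Cpow h1 k)%C (S n) - sum_n (fun k => a k * Cpow h2 k)%C (S n)
        - a 1%nat * (h1 - h2)) <= B / w * d * (2 * x - 2 * x ^ S n)).
{ induction n as [|n IH].
  - rewrite !Csum_S, !sum_O. simpl Cpow.
    match goal with |- Cmod ?e <= _ => replace e with (RtoC 0) by ring end.
    rewrite Cmod_0. simpl. right. ring.
  - rewrite (Csum_S _ (S n)), (Csum_S (fun k => (a k * Cpow h2 k)%C) (S n)).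
    set (S1 := sum_n (fun k => (a k * Cpow h1 k)%C) (S n) : C) in *.
    set (S2 := sum_n (fun k => (a k * Cpow h2 k)%C) (S n) : C) in *.
    replace (S1 + a (S (S n)) * Cpow h1 (S (S n)) - (S2 + a (S (S n)) * Cpow h2 (S (S n)))
      - a 1%nat * (h1 - h2))%C with ((S1 - S2 - a 1%nat * (h1 - h2))
      + a (S (S n)) * (Cpow h1 (S (S n)) - Cpow h2 (S (S n))))%C by ring.
    eapply Rle_trans; [apply Cmod_triangle|]. rewrite Cmod_mult.
    assert (Hp := Cpow_diff_bound (eta * w) h1 h2 (S n) ltac:(nra) ltac:(lra) ltac:(lra)).
    fold d in Hp.
    replace (2 * (eta * w)) with (x * w) in Hp by (unfold x; ring).
    assert (HBn := HB (S (S n))).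
    assert (Hwn : 0 < w ^ S n) by now apply pow_lt.
    assert (Hxn : 0 < x ^ S n) by now apply pow_lt.
    assert (Hterm : Cmod (a (S (S n))) * Cmod (Cpow h1 (S (S n)) - Cpow h2 (S (S n)))
       <= B / w * d * x ^ S n).
    { apply Rle_trans with (Cmod (a (S (S n))) * ((x * w) ^ S n * d)).
      - apply Rmult_le_compat_l; [apply Cmod_ge_0|exact Hp].
      - rewrite Rpow_mult_distr.
        apply Rle_trans with ((Cmod (a (S (S n))) * w ^ S (S n)) * (/ w * (x ^ S n * d))).
        + right. simpl pow. field. lra.
        + apply Rle_trans with (B * (/ w * (x ^ S n * d))); [|right; field; lra].
          apply Rmult_le_compat_r; [|easy].
          apply Rmult_le_pos; [apply Rlt_le, Rinv_0_lt_compat; lra|nra]. }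
    assert (HBw : 0 <= B / w * d) by (apply Rmult_le_pos; [apply Rdiv_le_0_compat; lra|easy]).
    assert (Hxx : x ^ S (S n) <= x ^ S n / 2) by (simpl pow in *; nra).
    nra. }
apply le_epsilon. intros e He.
destruct (L1 (e / 2) ltac:(lra)) as [N1 HN1]. destruct (L2 (e / 2) ltac:(lra)) as [N2 HN2].
set (n := (N1 + N2)%nat). specialize (HN1 (S n) ltac:(lia)). specialize (HN2 (S n) ltac:(lia)).
specialize (Est n).
set (S1 := sum_n (fun k => (a k * Cpow h1 k)%C) (S n) : C) in *.
set (S2 := sum_n (fun k => (a k * Cpow h2 k)%C) (S n) : C) in *.
replace (f z1 - f z2 - a 1%nat * (h1 - h2))%C with
  ((S1 - S2 - a 1%nat * (h1 - h2)) + (- (S1 - f z1) + (S2 - f z2)))%C by ring.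
eapply Rle_trans; [apply Cmod_triangle|].
pose proof (Cmod_triangle (- (S1 - f z1)) (S2 - f z2)) as HT. rewrite Cmod_opp in HT.
assert (B / w * d * (2 * x - 2 * x ^ S n) <= eps * d).
{ assert (0 < x ^ S n) by (apply pow_lt; lra).
  apply Rle_trans with (B / w * (4 * eta) * d).
  - replace (B / w * (4 * eta) * d) with (B / w * d * (2 * x)) by (unfold x; ring).
    apply Rmult_le_compat_l; [|lra]. apply Rmult_le_pos; [apply Rdiv_le_0_compat; lra|easy].
  - now apply Rmult_le_compat_r. }
lra.
Qed.

Lemma strict_derive_continuous f z0 l : strict_derive f z0 l ->
  forall eps, 0 < eps -> exists delta, 0 < delta /\
    forall z, Cmod (z - z0) < delta -> Cmod (f z - f z0) < eps.
Proof.
intros H eps Heps. destruct (H 1 Rlt_0_1) as (d & Hd & Hs).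
pose proof (Cmod_ge_0 l) as Hl.
exists (Rmin d (eps / (2 + Cmod l))). split.
- apply Rmin_pos; [easy|]. apply Rdiv_lt_0_compat; lra.
- intros z Hz. pose proof (Rmin_l d (eps / (2 + Cmod l))).
  pose proof (Rmin_r d (eps / (2 + Cmod l))).
  assert (Hz0 : Cmod (z0 - z0) < d)
    by (replace (z0 - z0)%C with (RtoC 0) by ring; rewrite Cmod_0; lra).
  specialize (Hs z z0 ltac:(lra) Hz0).
  replace (f z - f z0)%C with ((f z - f z0 - l * (z - z0)) + l * (z - z0))%C by ring.
  eapply Rle_lt_trans; [apply Cmod_triangle|]. rewrite Cmod_mult.
  pose proof (Cmod_ge_0 (z - z0)).
  assert (Cmod (z - z0) * (2 + Cmod l) < eps); [|nra].
  apply Rlt_div_r; lra.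
Qed.

(** The increment of f over one small step h from z is estimated twice, with [l0] and with [l];
    subtracting bounds |l - l0| h. *)
Lemma strict_derive_close f z0 l0 : strict_derive f z0 l0 ->
  forall eps, 0 < eps -> exists delta, 0 < delta /\
    forall z l, Cmod (z - z0) < delta -> strict_derive f z l -> Cmod (l - l0) < eps.
Proof.
intros H eps Heps. destruct (H (eps / 4) ltac:(lra)) as (d & Hd & Hs).
exists d. split; [easy|]. intros z l Hz Hl.
destruct (Hl (eps / 4) ltac:(lra)) as (d' & Hd' & Hs').
set (h := Rmin d' (d - Cmod (z - z0)) / 2).
assert (Hm : 0 < Rmin d' (d - Cmod (z - z0))) by (apply Rmin_pos; lra).
pose proof (Rmin_l d' (d - Cmod (z - z0))). pose proof (Rmin_r d' (d - Cmod (z - z0))).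
assert (Hh : 0 < h) by (unfold h; lra).
assert (Eh : Cmod (RtoC h) = h) by (rewrite Cmod_R, Rabs_pos_eq; lra).
assert (Hz1 : Cmod (z + RtoC h - z0) < d).
{ replace (z + RtoC h - z0)%C with ((z - z0) + RtoC h)%C by ring.
  eapply Rle_lt_trans; [apply Cmod_triangle|]. rewrite Eh. unfold h in *. lra. }
assert (Hz2 : Cmod (z + RtoC h - z) < d').
{ replace (z + RtoC h - z)%C with (RtoC h) by ring. rewrite Eh. unfold h in *. lra. }
assert (Hz3 : Cmod (z - z) < d')
  by (replace (z - z)%C with (RtoC 0) by ring; now rewrite Cmod_0).
specialize (Hs (z + RtoC h)%C z Hz1 Hz). specialize (Hs' (z + RtoC h)%C z Hz2 Hz3).
replace (z + RtoC h - z)%C with (RtoC h) in Hs, Hs' by ring. rewrite Eh in Hs, Hs'.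
assert (HT : Cmod ((l - l0) * RtoC h) <= eps / 2 * h).
{ replace ((l - l0) * RtoC h)%C with ((f (z + RtoC h)%C - f z - l0 * RtoC h)
    + - (f (z + RtoC h)%C - f z - l * RtoC h))%C by ring.
  eapply Rle_trans; [apply Cmod_triangle|]. rewrite Cmod_opp. lra. }
rewrite Cmod_mult, Eh in HT. nra.
Qed.

Lemma strict_derive_quotient f z0 l : strict_derive f z0 l ->
  forall eps, 0 < eps -> exists delta, 0 < delta /\
    forall z, z <> z0 -> Cmod (z - z0) < delta ->
      Cmod ((f z - f z0) / (z - z0) - l) <= eps.
Proof.
intros H eps Heps. destruct (H eps Heps) as (d & Hd & Hs).
exists d. split; [easy|]. intros z Hne Hz.
assert (H0 : Cmod (z0 - z0) < d)
  by (replace (z0 - z0)%C with (RtoC 0) by ring; now rewrite Cmod_0).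
specialize (Hs z z0 Hz H0).
assert (Hn : (z - z0)%C <> 0%C).
{ intros E. apply Hne. replace z with ((z - z0) + z0)%C by ring. rewrite E. ring. }
assert (Hp : 0 < Cmod (z - z0)) by now apply Cmod_gt_0.
replace ((f z - f z0) / (z - z0) - l)%C with ((f z - f z0 - l * (z - z0)) / (z - z0))%C
  by (field; exact Hn).
rewrite Cmod_div by exact Hn. apply Rle_div_l; easy.
Qed.

(** [C_derive], in which the theorem is stated, is a total function; this ties it to a genuine
    derivative and also yields uniqueness of [l]. *)
Lemma strict_derive_C_derive f z0 l : strict_derive f z0 l -> C_derive f z0 = l.
Proof.
intros H. apply is_C_lim_unique. apply filterlim_locally. intros eps.
destruct (strict_derive_quotient f z0 l H (eps / 2)) as (d & Hd & Hs).
{ destruct eps; simpl; lra. }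
destruct (locally_ball_norm (K := C_AbsRing) (V := C_NormedModule) z0 (mkposreal d Hd)) as [d' Hd'].
exists d'. intros z Hz Hne. specialize (Hd' z Hz).
apply C_NormedModule_mixin_compat1.
eapply Rle_lt_trans; [apply Hs; [exact Hne|exact Hd']|].
destruct eps; simpl; lra.
Qed.

Lemma strict_derive_const (c z0 : C) : strict_derive (fun _ => c) z0 0%C.
Proof.
intros eps Heps. exists 1. split; [lra|]. intros z1 z2 _ _.
replace (c - c - 0 * (z1 - z2))%C with (RtoC 0) by ring. rewrite Cmod_0.
apply Rmult_le_pos; [lra|apply Cmod_ge_0].
Qed.

Lemma strict_derive_plus f g z0 l m : strict_derive f z0 l -> strict_derive g z0 m ->
  strict_derive (fun z => f z + g z)%C z0 (l + m)%C.
Proof.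
intros Hf Hg eps Heps.
destruct (Hf (eps / 2) ltac:(lra)) as (d1 & Hd1 & H1).
destruct (Hg (eps / 2) ltac:(lra)) as (d2 & Hd2 & H2).
exists (Rmin d1 d2). split; [now apply Rmin_pos|]. intros z1 z2 Hz1 Hz2.
pose proof (Rmin_l d1 d2). pose proof (Rmin_r d1 d2).
specialize (H1 z1 z2 ltac:(lra) ltac:(lra)). specialize (H2 z1 z2 ltac:(lra) ltac:(lra)).
replace (f z1 + g z1 - (f z2 + g z2) - (l + m) * (z1 - z2))%C
  with ((f z1 - f z2 - l * (z1 - z2)) + (g z1 - g z2 - m * (z1 - z2)))%C by ring.
eapply Rle_trans; [apply Cmod_triangle|]. lra.
Qed.

(** The only product rule that polynomials call for, once they are written p(0) + z q(z). *)
Lemma strict_derive_id_mult f z0 l : strict_derive f z0 l ->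
  strict_derive (fun z => z * f z)%C z0 (f z0 + z0 * l)%C.
Proof.
intros Hf eps Heps. pose proof (Cmod_ge_0 z0) as H0.
destruct (strict_derive_continuous f z0 l Hf (eps / 4) ltac:(lra)) as (d1 & Hd1 & H1).
assert (He : 0 < eps / (4 * (1 + Cmod z0))) by (apply Rdiv_lt_0_compat; lra).
pose proof (Cmod_ge_0 l) as Hl.
destruct (Hf _ He) as (d2 & Hd2 & H2).
set (d3 := eps / (4 * (1 + Cmod l))). assert (Hd3 : 0 < d3) by (apply Rdiv_lt_0_compat; lra).
exists (Rmin (Rmin d1 1) (Rmin d2 d3)).
split; [repeat apply Rmin_pos; lra|]. intros z1 z2 Hz1 Hz2.
pose proof (Rmin_l (Rmin d1 1) (Rmin d2 d3)). pose proof (Rmin_r (Rmin d1 1) (Rmin d2 d3)).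
pose proof (Rmin_l d1 1). pose proof (Rmin_r d1 1). pose proof (Rmin_l d2 d3). pose proof (Rmin_r d2 d3).
specialize (H1 z1 ltac:(lra)). specialize (H2 z1 z2 ltac:(lra) ltac:(lra)).
set (D := Cmod (z1 - z2)) in *. assert (HD : 0 <= D) by apply Cmod_ge_0.
replace (z1 * f z1 - z2 * f z2 - (f z0 + z0 * l) * (z1 - z2))%C with
  ((f z1 - f z0) * (z1 - z2) + z2 * (f z1 - f z2 - l * (z1 - z2)) + (z2 - z0) * l * (z1 - z2))%C by ring.
eapply Rle_trans; [apply Cmod_triangle|].
eapply Rle_trans; [apply Rplus_le_compat_r, Cmod_triangle|].
rewrite !Cmod_mult. fold D.
assert (Hz2b : Cmod z2 <= 1 + Cmod z0).
{ replace z2 with ((z2 - z0) + z0)%C by ring.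
  eapply Rle_trans; [apply Cmod_triangle|]. lra. }
assert (T2 : Cmod z2 * Cmod (f z1 - f z2 - l * (z1 - z2)) <= eps / 4 * D).
{ apply Rle_trans with ((1 + Cmod z0) * (eps / (4 * (1 + Cmod z0)) * D)).
  - apply Rmult_le_compat; try assumption; apply Cmod_ge_0.
  - right. field. lra. }
assert (T3 : Cmod (z2 - z0) * Cmod l <= eps / 4).
{ apply Rle_trans with (d3 * (1 + Cmod l)).
  - apply Rmult_le_compat; try apply Cmod_ge_0; lra.
  - right. unfold d3. field. lra. }
assert (T1 : Cmod (f z1 - f z0) * D <= eps / 4 * D) by (apply Rmult_le_compat_r; lra).
assert (T3' : Cmod (z2 - z0) * Cmod l * D <= eps / 4 * D) by now apply Rmult_le_compat_r.
nra.
Qed.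

(** * Complex functions of real variables *)

(** Componentwise, because integrals with a parameter are handled on real and imaginary parts;
    [Ccont2_Cmod] is the bridge to moduli. *)
Definition Ccont2 (G : R -> R -> C) (x y : R) : Prop :=
  continuity_2d_pt (fun u v => Re (G u v)) x y /\
  continuity_2d_pt (fun u v => Im (G u v)) x y.

Lemma Im_le_Cmod z : Rabs (Im z) <= Cmod z.
Proof.
pose proof (Rmax_Cmod z). pose proof (Rmax_r (Rabs (fst z)) (Rabs (snd z))).
unfold Im. lra.
Qed.

Lemma Cmod_le_Re_Im z : Cmod z <= Rabs (Re z) + Rabs (Im z).
Proof.
replace (Cmod z) with (Cmod (RtoC (Re z) + Ci * RtoC (Im z))).
- eapply Rle_trans; [apply Cmod_triangle|].
  rewrite Cmod_mult, Cmod_Ci, !Cmod_R. lra.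
- f_equal. destruct z as [a b]. apply injective_projections; simpl; ring.
Qed.

Lemma Ccont2_Cmod G x y : Ccont2 G x y <->
  (forall eps, 0 < eps -> locally_2d (fun u v => Cmod (G u v - G x y) < eps) x y).
Proof.
split.
- intros [H1 H2] eps Heps.
  specialize (H1 (mkposreal (eps / 2) ltac:(lra))). specialize (H2 (mkposreal (eps / 2) ltac:(lra))).
  apply (locally_2d_impl (fun u v => Rabs (Re (G u v) - Re (G x y)) < eps / 2 /\
    Rabs (Im (G u v) - Im (G x y)) < eps / 2)).
  + apply locally_2d_forall. intros u v [A1 A2].
    eapply Rle_lt_trans; [apply Cmod_le_Re_Im|].
    change (Rabs (Re (G u v) - Re (G x y)) + Rabs (Im (G u v) - Im (G x y)) < eps). lra.
  + now apply locally_2d_and.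
- intros H. split; intros [eps Heps]; generalize (H eps Heps); apply locally_2d_impl, locally_2d_forall;
    intros u v Hu; simpl; eapply Rle_lt_trans; [|exact Hu| |exact Hu].
  + apply (re_le_Cmod (G u v - G x y)).
  + apply (Im_le_Cmod (G u v - G x y)).
Qed.

Lemma Ccont2_const c x y : Ccont2 (fun _ _ => c) x y.
Proof. split; apply continuity_2d_pt_const. Qed.

Lemma Ccont2_plus F G x y : Ccont2 F x y -> Ccont2 G x y ->
  Ccont2 (fun u v => F u v + G u v)%C x y.
Proof. intros [] []. split; now apply continuity_2d_pt_plus. Qed.

Lemma Ccont2_minus F G x y : Ccont2 F x y -> Ccont2 G x y ->
  Ccont2 (fun u v => F u v - G u v)%C x y.
Proof.
intros [] []. split; now apply continuity_2d_pt_minus.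
Qed.

Lemma Ccont2_mult F G x y : Ccont2 F x y -> Ccont2 G x y ->
  Ccont2 (fun u v => F u v * G u v)%C x y.
Proof.
intros [] []. split.
- apply continuity_2d_pt_minus; now apply continuity_2d_pt_mult.
- apply continuity_2d_pt_plus; now apply continuity_2d_pt_mult.
Qed.

Lemma Cnorm2_neq_0 (z : C) : z <> 0%C -> Re z ^ 2 + Im z ^ 2 <> 0.
Proof.
intros Hz. rewrite <- Cmod2_alt. apply pow_nonzero.
apply Rgt_not_eq. now apply Cmod_gt_0.
Qed.

Lemma Ccont2_inv G x y : Ccont2 G x y -> G x y <> 0%C ->
  Ccont2 (fun u v => / G u v)%C x y.
Proof.
intros [H1 H2] H0. pose proof (Cnorm2_neq_0 _ H0) as HN.
assert (Hi : continuity_2d_pt (fun u v => / (Re (G u v) ^ 2 + Im (G u v) ^ 2)) x y).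
{ apply continuity_2d_pt_inv; [|exact HN]. simpl.
  apply continuity_2d_pt_plus; repeat apply continuity_2d_pt_mult; auto;
    apply continuity_2d_pt_const. }
split; apply continuity_2d_pt_mult; auto. now apply continuity_2d_pt_opp.
Qed.

Lemma Ccont2_comp f G x y :
  (forall eps, 0 < eps -> exists delta, 0 < delta /\
    forall z, Cmod (z - G x y) < delta -> Cmod (f z - f (G x y)) < eps) ->
  Ccont2 G x y -> Ccont2 (fun u v => f (G u v)) x y.
Proof.
intros Hf HG. apply Ccont2_Cmod. intros eps Heps.
destruct (Hf eps Heps) as (d & Hd & H). apply Ccont2_Cmod with (eps := d) in HG; [|easy].
revert HG. apply locally_2d_impl, locally_2d_forall. auto.
Qed.

Definition is_Cderive (g : R -> C) (t : R) (l : C) : Prop :=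
  is_derive (fun s => Re (g s)) t (Re l) /\ is_derive (fun s => Im (g s)) t (Im l).

Lemma is_derive_eps (f : R -> R) x l : is_derive f x l <->
  (forall eps, 0 < eps -> exists delta, 0 < delta /\ forall y, Rabs (y - x) < delta ->
    Rabs (f y - f x - l * (y - x)) <= eps * Rabs (y - x)).
Proof.
rewrite is_derive_Reals. split; intros H eps Heps.
- destruct (H eps Heps) as [[d Hd] Hs]. exists d. split; [easy|]. intros y Hy.
  destruct (Req_dec (y - x) 0) as [E|Hne].
  + replace y with x by lra. rewrite !Rminus_diag, Rmult_0_r, Rminus_0_r, Rabs_R0. lra.
  + specialize (Hs (y - x) Hne Hy). replace (x + (y - x)) with y in Hs by ring.
    replace (f y - f x - l * (y - x)) with (((f y - f x) / (y - x) - l) * (y - x)) by (field; easy).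
    rewrite Rabs_mult. apply Rmult_le_compat_r; [apply Rabs_pos|]. lra.
- destruct (H (eps / 2) ltac:(lra)) as (d & Hd & Hs). exists (mkposreal d Hd).
  intros h Hh0 Hh. simpl in Hh. specialize (Hs (x + h)). replace (x + h - x) with h in Hs by ring.
  specialize (Hs Hh).
  replace ((f (x + h) - f x) / h - l) with ((f (x + h) - f x - l * h) / h) by (field; easy).
  pose proof (Rabs_pos_lt h Hh0).
  rewrite Rabs_div by easy. apply Rlt_div_l; [easy|]. nra.
Qed.

(** The modulus form is what composes with [strict_derive], which does not split into components. *)
Lemma is_Cderive_eps (g : R -> C) x l : is_Cderive g x l <->
  (forall eps, 0 < eps -> exists delta, 0 < delta /\ forall y, Rabs (y - x) < delta ->
    Cmod (g y - g x - l * RtoC (y - x)) <= eps * Rabs (y - x)).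
Proof.
assert (ER : forall y, Re (g y - g x - l * RtoC (y - x)) = Re (g y) - Re (g x) - Re l * (y - x))
  by (intros y; simpl; unfold Re; ring).
assert (EI : forall y, Im (g y - g x - l * RtoC (y - x)) = Im (g y) - Im (g x) - Im l * (y - x))
  by (intros y; simpl; unfold Im; ring).
unfold is_Cderive. rewrite !is_derive_eps. split.
- intros [H1 H2] eps Heps.
  destruct (H1 (eps / 2) ltac:(lra)) as (d1 & Hd1 & Hs1).
  destruct (H2 (eps / 2) ltac:(lra)) as (d2 & Hd2 & Hs2).
  exists (Rmin d1 d2). split; [now apply Rmin_pos|]. intros y Hy.
  pose proof (Rmin_l d1 d2). pose proof (Rmin_r d1 d2).
  specialize (Hs1 y ltac:(lra)). specialize (Hs2 y ltac:(lra)).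
  eapply Rle_trans; [apply Cmod_le_Re_Im|]. rewrite ER, EI. lra.
- intros H. split; intros eps Heps; destruct (H eps Heps) as (d & Hd & Hs);
    exists d; (split; [easy|]); intros y Hy; specialize (Hs y Hy).
  + rewrite <- ER. eapply Rle_trans; [apply re_le_Cmod|exact Hs].
  + rewrite <- EI. eapply Rle_trans; [apply Im_le_Cmod|exact Hs].
Qed.

Lemma is_Cderive_comp f g t l d : strict_derive f (g t) d -> is_Cderive g t l ->
  is_Cderive (fun s => f (g s)) t (d * l)%C.
Proof.
intros Hf Hg. rewrite is_Cderive_eps in *. intros eps Heps.
pose proof (Cmod_ge_0 l). pose proof (Cmod_ge_0 d).
destruct (Hf (eps / (2 * (1 + Cmod l)))) as (d1 & Hd1 & H1); [apply Rdiv_lt_0_compat; lra|].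
set (e := Rmin 1 (eps / (2 * (1 + Cmod d)))).
assert (He : 0 < e) by (apply Rmin_pos; [lra|apply Rdiv_lt_0_compat; lra]).
destruct (Hg e He) as (d2 & Hd2 & H2).
exists (Rmin d2 (d1 / (1 + Cmod l))).
split; [apply Rmin_pos; [easy|apply Rdiv_lt_0_compat; lra]|]. intros y Hy.
pose proof (Rmin_l d2 (d1 / (1 + Cmod l))). pose proof (Rmin_r d2 (d1 / (1 + Cmod l))).
specialize (H2 y ltac:(lra)). pose proof (Rabs_pos (y - t)) as Ha.
assert (He1 : e <= 1) by apply Rmin_l.
assert (He2 : Cmod d * e <= eps / 2).
{ apply Rle_trans with ((1 + Cmod d) * (eps / (2 * (1 + Cmod d)))); [|right; field; lra].
  apply Rmult_le_compat; [lra|lra|lra|apply Rmin_r]. }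
assert (Hgy : Cmod (g y - g t) <= (1 + Cmod l) * Rabs (y - t)).
{ replace (g y - g t)%C with ((g y - g t - l * RtoC (y - t)) + l * RtoC (y - t))%C by ring.
  eapply Rle_trans; [apply Cmod_triangle|]. rewrite Cmod_mult, Cmod_R. nra. }
assert (Hgd : Cmod (g y - g t) < d1).
{ eapply Rle_lt_trans; [exact Hgy|]. rewrite Rmult_comm. apply Rlt_div_r; lra. }
specialize (H1 (g y) (g t) Hgd).
replace (g t - g t)%C with (RtoC 0) in H1 by ring. rewrite Cmod_0 in H1. specialize (H1 Hd1).
replace (f (g y) - f (g t) - d * l * RtoC (y - t))%C with
  ((f (g y) - f (g t) - d * (g y - g t)) + d * (g y - g t - l * RtoC (y - t)))%C by ring.
eapply Rle_trans; [apply Cmod_triangle|]. rewrite Cmod_mult.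
assert (A1 : Cmod (f (g y) - f (g t) - d * (g y - g t)) <= eps / 2 * Rabs (y - t)).
{ eapply Rle_trans; [exact H1|].
  apply Rle_trans with (eps / (2 * (1 + Cmod l)) * ((1 + Cmod l) * Rabs (y - t))).
  - apply Rmult_le_compat_l; [|exact Hgy]. apply Rlt_le, Rdiv_lt_0_compat; lra.
  - right. field. lra. }
assert (A2 : Cmod d * Cmod (g y - g t - l * RtoC (y - t)) <= eps / 2 * Rabs (y - t)).
{ apply Rle_trans with (Cmod d * (e * Rabs (y - t))); [now apply Rmult_le_compat_l|].
  rewrite <- Rmult_assoc. now apply Rmult_le_compat_r. }
lra.
Qed.

Lemma is_Cderive_eq g t l l' : is_Cderive g t l -> l = l' -> is_Cderive g t l'.
Proof. now intros H <-. Qed.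

Lemma is_Cderive_ext f g t l : (forall s, f s = g s) -> is_Cderive f t l -> is_Cderive g t l.
Proof.
intros E [H1 H2]. split; [apply (is_derive_ext (fun s => Re (f s)))|apply (is_derive_ext (fun s => Im (f s)))];
  auto; intros s; now rewrite E.
Qed.

Lemma is_Cderive_const c t : is_Cderive (fun _ => c) t 0%C.
Proof. split; [apply (is_derive_const (Re c))|apply (is_derive_const (Im c))]. Qed.

Lemma is_Cderive_plus f g t l m : is_Cderive f t l -> is_Cderive g t m ->
  is_Cderive (fun s => f s + g s)%C t (l + m)%C.
Proof.
intros [F1 F2] [G1 G2]. split.
- exact (is_derive_plus _ _ t _ _ F1 G1).
- exact (is_derive_plus _ _ t _ _ F2 G2).
Qed.

Lemma is_Cderive_mult f g t l m : is_Cderive f t l -> is_Cderive g t m ->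
  is_Cderive (fun s => f s * g s)%C t (l * g t + f t * m)%C.
Proof.
intros [F1 F2] [G1 G2].
pose proof (is_derive_mult _ _ t _ _ F1 G1 Rmult_comm) as M11.
pose proof (is_derive_mult _ _ t _ _ F2 G2 Rmult_comm) as M22.
pose proof (is_derive_mult _ _ t _ _ F1 G2 Rmult_comm) as M12.
pose proof (is_derive_mult _ _ t _ _ F2 G1 Rmult_comm) as M21.
split.
- replace (Re (l * g t + f t * m)) with
    ((Re l * Re (g t) + Re (f t) * Re m) - (Im l * Im (g t) + Im (f t) * Im m))
    by (simpl; unfold Re, Im; ring).
  exact (is_derive_minus _ _ t _ _ M11 M22).
- replace (Im (l * g t + f t * m)) with
    ((Re l * Im (g t) + Re (f t) * Im m) + (Im l * Re (g t) + Im (f t) * Re m))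
    by (simpl; unfold Re, Im; ring).
  exact (is_derive_plus _ _ t _ _ M12 M21).
Qed.

(** The real part of 1/(X+iY). The imaginary part is minus the same expression with X and Y
    exchanged, so one computation serves both. *)
Lemma is_derive_inv_parts (X Y : R -> R) t x y :
  is_derive X t x -> is_derive Y t y -> X t ^ 2 + Y t ^ 2 <> 0 ->
  is_derive (fun s => X s / (X s ^ 2 + Y s ^ 2)) t
    ((x * (Y t ^ 2 - X t ^ 2) - 2 * X t * Y t * y) / (X t ^ 2 + Y t ^ 2) ^ 2).
Proof.
intros HX HY H0. auto_derive.
- repeat apply conj; try easy; try (now exists x); try (now exists y).
- replace (Derive (fun x0 : R => X x0) t) with x by (symmetry; now apply is_derive_unique).
  replace (Derive (fun x0 : R => Y x0) t) with y by (symmetry; now apply is_derive_unique).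
  field. exact H0.
Qed.

Lemma is_Cderive_inv g t l : is_Cderive g t l -> g t <> 0%C ->
  is_Cderive (fun s => / g s)%C t (- l * (/ g t * / g t))%C.
Proof.
intros [G1 G2] H0. pose proof (Cnorm2_neq_0 _ H0) as HN.
pose proof (is_derive_inv_parts _ _ _ _ _ G1 G2 HN) as D1.
assert (HN' : Im (g t) ^ 2 + Re (g t) ^ 2 <> 0) by lra.
pose proof (is_derive_inv_parts _ _ _ _ _ G2 G1 HN') as D2.
split.
- apply (is_derive_ext (fun s => Re (g s) / (Re (g s) ^ 2 + Im (g s) ^ 2))); [reflexivity|].
  match type of D1 with is_derive _ _ ?d => replace (Re _) with d; [exact D1|] end.
  simpl. unfold Re, Im in *. field. intros E. apply HN. rewrite <- E. ring.
- apply (is_derive_ext (fun s => - (Im (g s) / (Im (g s) ^ 2 + Re (g s) ^ 2)))).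
  + intros s. unfold Re, Im. simpl. rewrite (Rplus_comm (snd (g s) * _)). unfold Rdiv. ring.
  + match type of D2 with is_derive _ _ ?d => replace (Im _) with (- d);
      [exact (is_derive_opp _ _ _ D2)|] end.
    simpl. unfold Re, Im in *. field.
    intros E; apply HN; rewrite <- E; ring.
Qed.

Lemma continuity_2d_pt_1d (g : R -> R -> R) x y :
  continuity_2d_pt g x y -> continuous (g x) y.
Proof.
intros H. apply filterlim_locally. intros eps.
exact (locally_2d_1d_const_x _ _ _ (H eps)).
Qed.

(** The t-derivative of the integral is the increment of h over a period, that is 0. Derivatives are
    asked only for 0 < t < 1, since the h used for Cauchy's formula has a factor 1/t; the ends are
    reached by continuity of g. *)
Lemma homotopy_RInt (g g' h : R -> R -> R) (b : R) : 0 <= b ->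
  (forall t th, 0 <= t <= 1 -> continuity_2d_pt g t th) ->
  (forall t th, 0 < t < 1 -> continuity_2d_pt g' t th) ->
  (forall t th, 0 < t < 1 -> is_derive (fun s => g s th) t (g' t th)) ->
  (forall t th, 0 < t < 1 -> is_derive (fun s => h t s) th (g' t th)) ->
  (forall t, 0 < t < 1 -> h t 0 = h t b) ->
  RInt (g 0) 0 b = RInt (g 1) 0 b.
Proof.
intros Hb Cg Cg' Dg Dh Hper.
assert (Hmin : Rmin 0 b = 0) by now apply Rmin_left.
assert (Hmax : Rmax 0 b = b) by now apply Rmax_right.
assert (Ig : forall t, 0 <= t <= 1 -> ex_RInt (g t) 0 b).
{ intros t Ht. apply (ex_RInt_continuous (V := R_CompleteNormedModule)). intros th _.
  now apply continuity_2d_pt_1d, Cg. }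
assert (DJ : forall t, 0 < t < 1 -> is_derive (fun s => RInt (g s) 0 b) t 0).
{ intros t Ht.
  assert (Hloc : locally t (fun s => 0 < s < 1)).
  { apply filter_and; [apply (open_gt 0)|apply (open_lt 1)]; easy. }
  assert (ED : RInt (fun th => Derive (fun u => g u th) t) 0 b = 0).
  { rewrite (RInt_ext _ (g' t)) by (intros th _; now apply is_derive_unique, Dg).
    apply is_RInt_unique. replace 0 with (minus (h t b) (h t 0)) at 2
      by (rewrite Hper by easy; apply (minus_eq_zero (G := R_AbelianGroup))).
    apply (is_RInt_derive (V := R_CompleteNormedModule)); intros th _; [now apply Dh|].
    now apply continuity_2d_pt_1d, Cg'. }
  refine (eq_ind _ (is_derive (fun s => RInt (g s) 0 b) t) _ 0 ED).
  apply (is_derive_RInt_param g).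
  - revert Hloc. apply filter_imp. intros s Hs th _. exists (g' s th). now apply Dg.
  (* [Derive] coincides with [g'] only near t, since nothing is known outside (0,1). *)
  - intros th _. apply (continuity_2d_pt_ext_loc g').
    + destruct Hloc as [d Hd]. exists d. intros u v Hu _. symmetry.
      apply is_derive_unique, Dg. now apply Hd.
    + now apply Cg'.
  - revert Hloc. apply filter_imp. intros s Hs. apply Ig. lra. }
assert (Jconst : forall s t, 0 < s < 1 -> 0 < t < 1 -> RInt (g s) 0 b = RInt (g t) 0 b).
{ intros s t Hs Ht.
  assert (Hin : forall x, Rmin s t <= x <= Rmax s t -> 0 < x < 1).
  { intros x Hx. pose proof (Rmin_glb_lt s t 0 (proj1 Hs) (proj1 Ht)).
    pose proof (Rmax_lub_lt s t 1 (proj2 Hs) (proj2 Ht)). lra. }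
  destruct (MVT_gen (fun s => RInt (g s) 0 b) s t (fun _ => 0)) as (c & _ & E).
  - intros x Hx. apply DJ, Hin. lra.
  - intros x Hx. apply continuity_pt_filterlim.
    apply (ex_derive_continuous (fun s => RInt (g s) 0 b)). exists 0. now apply DJ, Hin.
  - lra. }
(* An interior s close to t0 is compared with t0 by uniform continuity along t = t0. The tolerance
   e/(1+b) makes its integral over [0,b] at most e, also when b = 0. *)
assert (Jend : forall t0, (t0 = 0 \/ t0 = 1) -> RInt (g t0) 0 b = RInt (g (/ 2)) 0 b).
{ intros t0 Ht0. apply Rminus_diag_uniq, Rabs_eq_0, Rle_antisym; [|apply Rabs_pos].
  apply le_epsilon. intros e He. rewrite Rplus_0_l.
  assert (He' : 0 < e / (1 + b)) by (apply Rdiv_lt_0_compat; lra).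
  destruct (uniform_continuity_2d_1d' g 0 b t0) with (eps := mkposreal _ He') as [d Hd].
  { intros th Hth. apply Cg. lra. }
  set (dd := Rmin (d / 2) (/ 2)).
  assert (Hdd : 0 < dd) by (apply Rmin_pos; [apply is_pos_div_2|lra]).
  pose proof (Rmin_l (d / 2) (/ 2)). pose proof (Rmin_r (d / 2) (/ 2)). fold dd in H, H0.
  assert (exists s, 0 < s < 1 /\ Rabs (s - t0) <= dd) as (s & Hs & Hst).
  { destruct Ht0 as [->| ->]; [exists dd|exists (1 - dd)]; (split; [lra|]);
      apply Rabs_le; lra. }
  rewrite (Jconst (/ 2) s) by lra.
  pose proof (cond_pos d).
  change (Rabs (minus (RInt (g t0) 0 b) (RInt (g s) 0 b)) <= e).
  rewrite <- (RInt_minus (V := R_CompleteNormedModule)) by (apply Ig; destruct Ht0; lra).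
  apply Rle_trans with ((b - 0) * (e / (1 + b))).
  - apply (norm_RInt_le_const (V := R_NormedModule) (fun x => minus (g t0 x) (g s x))); [easy| |].
    + intros th Hth. change (Rabs (g t0 th - g s th) <= e / (1 + b)).
      rewrite Rabs_minus_sym.
      apply Rabs_le_between in Hst. apply Rlt_le.
      apply (Hd th t0 th s); try lra. rewrite Rminus_diag, Rabs_R0. apply cond_pos.
    + apply (RInt_correct (fun x => minus (g t0 x) (g s x))).
      apply (ex_RInt_minus (V := R_NormedModule)); apply Ig; destruct Ht0; lra.
  - rewrite Rminus_0_r. unfold Rdiv. rewrite (Rmult_comm e), <- Rmult_assoc.
    rewrite <- (Rmult_1_l e) at 2. apply Rmult_le_compat_r; [lra|].
    apply Rle_div_l; lra. }
rewrite (Jend 0), (Jend 1); auto.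
Qed.

(** * Contour integrals on the ellipse *)

(** The dummy first variable lets the two-variable closure lemmas serve on the contour as well. *)
Definition Ccont (F : R -> C) : Prop := forall th, Ccont2 (fun _ s => F s) 0 th.

Definition CInt (F : R -> C) : C :=
  (RInt (fun th => Re (F th)) 0 (2 * PI), RInt (fun th => Im (F th)) 0 (2 * PI)).

Lemma Ccont_ex_RInt F : Ccont F ->
  ex_RInt (fun th => Re (F th)) 0 (2 * PI) /\ ex_RInt (fun th => Im (F th)) 0 (2 * PI).
Proof.
intros HF.
split; apply (ex_RInt_continuous (V := R_CompleteNormedModule)); intros th _;
  destruct (HF th) as [H1 H2].
- exact (continuity_2d_pt_1d _ _ _ H1).
- exact (continuity_2d_pt_1d _ _ _ H2).
Qed.

Lemma CInt_ext F G : (forall th, F th = G th) -> CInt F = CInt G.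
Proof.
intros E. apply injective_projections; apply RInt_ext; intros th _; now rewrite E.
Qed.

Lemma CInt_plus F G : Ccont F -> Ccont G ->
  CInt (fun th => F th + G th)%C = (CInt F + CInt G)%C.
Proof.
intros HF HG. apply Ccont_ex_RInt in HF as []. apply Ccont_ex_RInt in HG as [].
apply injective_projections; now apply (RInt_plus (V := R_CompleteNormedModule)).
Qed.

Lemma CInt_scal c F : Ccont F -> CInt (fun th => c * F th)%C = (c * CInt F)%C.
Proof.
intros HF. apply Ccont_ex_RInt in HF as [H1 H2].
assert (S1 : forall k, ex_RInt (fun th => k * Re (F th)) 0 (2 * PI) /\
  RInt (fun th => k * Re (F th)) 0 (2 * PI) = k * RInt (fun th => Re (F th)) 0 (2 * PI)).
{ intros k. split; [exact (ex_RInt_scal _ _ _ k H1)|].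
  exact (RInt_scal (V := R_CompleteNormedModule) _ _ _ k H1). }
assert (S2 : forall k, ex_RInt (fun th => k * Im (F th)) 0 (2 * PI) /\
  RInt (fun th => k * Im (F th)) 0 (2 * PI) = k * RInt (fun th => Im (F th)) 0 (2 * PI)).
{ intros k. split; [exact (ex_RInt_scal _ _ _ k H2)|].
  exact (RInt_scal (V := R_CompleteNormedModule) _ _ _ k H2). }
apply injective_projections; simpl.
- rewrite <- (proj2 (S1 (fst c))), <- (proj2 (S2 (snd c))).
  apply (RInt_minus (V := R_CompleteNormedModule)); [apply S1|apply S2].
- rewrite <- (proj2 (S2 (fst c))), <- (proj2 (S1 (snd c))).
  apply (RInt_plus (V := R_CompleteNormedModule)); [apply S2|apply S1].
Qed.

(** Estimated in the modulus norm of C as a real normed module: bounding the two components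
    separately would lose a constant. With [k] the speed of the parametrization, the arc length
    appears. *)
Lemma CInt_bound F k m : Ccont F -> ex_RInt k 0 (2 * PI) ->
  (forall th, Cmod (F th) <= m * k th) -> Cmod (CInt F) <= m * RInt k 0 (2 * PI).
Proof.
intros HF Hk Hb. apply Ccont_ex_RInt in HF as [H1 H2].
pose proof PI_RGT_0. rewrite Cmod_norm.
apply (norm_RInt_le (V := C_R_NormedModule) F (fun th => m * k th) 0 (2 * PI)); [lra| | |].
- intros th _. specialize (Hb th). now rewrite Cmod_norm in Hb.
- apply is_RInt_fct_extend_pair.
  + exact (RInt_correct _ _ _ H1).
  + exact (RInt_correct _ _ _ H2).
- apply (is_RInt_scal k _ _ m). exact (RInt_correct _ _ _ Hk).
Qed.

Lemma CInt_homotopy (G G' H : R -> R -> C) :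
  (forall t th, 0 <= t <= 1 -> Ccont2 G t th) ->
  (forall t th, 0 < t < 1 -> Ccont2 G' t th) ->
  (forall t th, 0 < t < 1 -> is_Cderive (fun s => G s th) t (G' t th)) ->
  (forall t th, 0 < t < 1 -> is_Cderive (fun s => H t s) th (G' t th)) ->
  (forall t, 0 < t < 1 -> H t 0 = H t (2 * PI)) ->
  CInt (G 0) = CInt (G 1).
Proof.
intros C1 C2 D1 D2 Hper. pose proof PI_RGT_0.
apply injective_projections.
- apply (homotopy_RInt (fun t s => Re (G t s)) (fun t s => Re (G' t s)) (fun t s => Re (H t s)));
    [lra|intros; now apply C1|intros; now apply C2|intros; now apply D1|intros; now apply D2|].
  intros t Ht. now rewrite Hper.
- apply (homotopy_RInt (fun t s => Im (G t s)) (fun t s => Im (G' t s)) (fun t s => Im (H t s)));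
    [lra|intros; now apply C1|intros; now apply C2|intros; now apply D1|intros; now apply D2|].
  intros t Ht. now rewrite Hper.
Qed.

(** * Geometry of the ellipse and Cauchy's formula on it *)

Definition ellipse (rho th : R) : C :=
  ((rho + / rho) / 2 * cos th, (rho - / rho) / 2 * sin th).

Definition ellipse' (rho th : R) : C :=
  (- ((rho + / rho) / 2 * sin th), (rho - / rho) / 2 * cos th).

Lemma ellipse_joukowski rho th : 0 < rho ->
  let u := (RtoC rho * (cos th, sin th))%C in
  Cmod u = rho /\ bernstein_param rho th = ((u + / u) / 2)%C /\
  bernstein_param rho th = ellipse rho th.
Proof.
intros Hr u. pose proof (sin2_cos2 th) as Hcs. unfold Rsqr in Hcs.
assert (E1 : Cmod (cos th, sin th) = 1).
{ unfold Cmod. simpl fst; simpl snd. replace (cos th ^ 2 + sin th ^ 2) with 1 by (simpl; lra).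
  apply sqrt_1. }
split; [|split; [reflexivity|]].
- unfold u. rewrite Cmod_mult, Cmod_R, E1, Rabs_pos_eq; lra.
- change (bernstein_param rho th) with ((u + / u) / 2)%C.
  assert (Ei : (/ u)%C = (RtoC (/ rho) * (cos th, (- sin th)%R))%C).
  { assert (Hu : u <> 0%C).
    { apply Cmod_gt_0. unfold u. rewrite Cmod_mult, Cmod_R, E1, Rabs_pos_eq; lra. }
    assert (Hm : (u * (RtoC (/ rho) * (cos th, (- sin th)%R)) = 1)%C).
    { unfold u. apply injective_projections; simpl.
      - transitivity (sin th * sin th + cos th * cos th); [field; lra|exact Hcs].
      - field. lra. }
    rewrite <- (Cmult_1_r (/ u)), <- Hm. field. exact Hu. }
  rewrite Ei. unfold u, ellipse. apply injective_projections; simpl; field; lra.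
Qed.

Lemma ellipse_a_gt1 rho : 1 < rho -> 1 < (rho + / rho) / 2.
Proof.
intros Hr. assert (E : rho * / rho = 1) by (field; lra).
pose proof (Rinv_0_lt_compat rho ltac:(lra)). nra.
Qed.

Lemma ellipse_dist rho th y : 1 < rho -> -1 <= y <= 1 ->
  (rho + / rho) / 2 - 1 <= Cmod (ellipse rho th - RtoC y).
Proof.
intros Hr Hy. pose proof (ellipse_a_gt1 rho Hr) as Ha.
assert (Eab : ((rho - / rho) / 2) ^ 2 = ((rho + / rho) / 2) ^ 2 - 1) by (field; lra).
unfold ellipse. set (a := (rho + / rho) / 2) in *. set (b := (rho - / rho) / 2) in *.
pose proof (sin2_cos2 th) as Hcs. unfold Rsqr in Hcs.
unfold Cmod. simpl fst; simpl snd.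
apply Rsqr_incr_0_var; [|apply sqrt_pos].
rewrite Rsqr_sqrt by (pose proof (pow2_ge_0 (a * cos th + - y)); pose proof (pow2_ge_0 (b * sin th + - 0)); lra).
unfold Rsqr. set (c := cos th) in *. set (s := sin th) in *.
assert (Es : s * s = 1 - c * c) by lra.
assert (Hc : -1 <= c <= 1) by (unfold c; apply COS_bound).
(* Uses b^2 = a^2 - 1. Since (1-cy)^2 - (1-y^2)(1-c^2) = (c-y)^2, the new expression equals (a-1)^2
   + 2(a-1)(1-cy) + (c-y)^2. *)
replace ((a * c + - y) ^ 2 + (b * s + - 0) ^ 2) with ((a - c * y) ^ 2 - (1 - y ^ 2) * (1 - c ^ 2)).
2:{ replace ((b * s + - 0) ^ 2) with (b ^ 2 * (s * s)) by ring. rewrite Eab, Es. ring. }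
assert (Hcy : c * y <= 1) by nra.
assert (0 <= (c - y) ^ 2) by apply pow2_ge_0.
assert (0 <= (a - 1) * (1 - c * y)) by (apply Rmult_le_pos; lra).
nra.
Qed.

Lemma angle_exists x y : x ^ 2 + y ^ 2 = 1 ->
  exists th, 0 <= th < 2 * PI /\ cos th = x /\ sin th = y.
Proof.
intros H. assert (Hx : -1 <= x <= 1) by nra.
pose proof (acos_bound x) as Hb. pose proof PI_RGT_0.
assert (Es : sin (acos x) = sqrt (1 - x ^ 2)) by (rewrite sin_acos; [f_equal; unfold Rsqr; ring|easy]).
assert (Hsq : sqrt (1 - x ^ 2) = Rabs y).
{ replace (1 - x ^ 2) with (Rsqr y) by (unfold Rsqr; lra). apply sqrt_Rsqr_abs. }
destruct (Rle_dec 0 y) as [Hy|Hy].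
- exists (acos x). split; [lra|]. split; [now apply cos_acos|].
  rewrite Es, Hsq. now apply Rabs_pos_eq.
- exists (2 * PI - acos x). split; [|split].
  + enough (acos x <> 0) by lra. intros E. rewrite E, sin_0, Hsq in Es.
    revert Es. rewrite Rabs_left by lra. lra.
  + rewrite cos_minus, cos_2PI, sin_2PI, cos_acos by easy. ring.
  + rewrite sin_minus, cos_2PI, sin_2PI, Es, Hsq, Rabs_left by lra. ring.
Qed.

(** Rescaling by the semi-axes turns the region into the unit disc, where polar coordinates give the
    segment: sqrt q is its parameter. The centre has no angle and is treated apart. *)
Lemma bernstein_region_intro rho z : 1 < rho ->
  (Re z / ((rho + / rho) / 2)) ^ 2 + (Im z / ((rho - / rho) / 2)) ^ 2 <= 1 ->
  bernstein_region rho z.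
Proof.
intros Hr H. pose proof (ellipse_a_gt1 rho Hr) as Ha.
assert (Hb : 0 < (rho - / rho) / 2).
{ assert (/ rho < 1) by (rewrite <- Rinv_1; apply Rinv_lt_contravar; lra). lra. }
set (a := (rho + / rho) / 2) in *. set (b := (rho - / rho) / 2) in *.
set (q := (Re z / a) ^ 2 + (Im z / b) ^ 2) in *.
assert (Hq0 : 0 <= q) by (unfold q; pose proof (pow2_ge_0 (Re z / a)); pose proof (pow2_ge_0 (Im z / b)); lra).
pose proof PI_RGT_0.
destruct (Req_dec q 0) as [E|Hne].
- exists 0, (bernstein_param rho 0). split; [lra|]. split.
  + exists 0. split; [lra|reflexivity].
  + assert (E1 : Re z / a = 0) by (unfold q in E; pose proof (pow2_ge_0 (Re z / a)); pose proof (pow2_ge_0 (Im z / b)); nra).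
    assert (E2 : Im z / b = 0) by (unfold q in E; pose proof (pow2_ge_0 (Re z / a)); pose proof (pow2_ge_0 (Im z / b)); nra).
    replace z with (RtoC 0); [ring|].
    apply injective_projections; simpl; symmetry.
    * replace (fst z) with (Re z / a * a) by (unfold Re; field; lra). rewrite E1. ring.
    * replace (snd z) with (Im z / b * b) by (unfold Im; field; lra). rewrite E2. ring.
- set (r := sqrt q). assert (Hr0 : 0 < r) by (apply sqrt_lt_R0; lra).
  assert (Hrr : r * r = q) by now apply sqrt_sqrt.
  destruct (angle_exists (Re z / a / r) (Im z / b / r)) as (th & Hth & Ec & Es).
  { replace ((Re z / a / r) ^ 2 + (Im z / b / r) ^ 2) with (q / (r * r)).
    - rewrite Hrr. field. lra.
    - unfold q. field. lra. }
  exists r, (bernstein_param rho th). split; [nra|]. split; [now exists th|].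
  destruct (ellipse_joukowski rho th ltac:(lra)) as (_ & _ & ->).
  unfold ellipse. fold a b. rewrite Ec, Es.
  apply injective_projections; simpl; unfold Re, Im; field; lra.
Qed.

(** In the rescaled coordinates this is the convexity of the unit disc, applied to (y/a, 0) and (cos
    th, sin th). It keeps the contraction to y inside the domain of analyticity. *)
Lemma bernstein_region_star rho y t th : 1 < rho -> -1 <= y <= 1 -> 0 <= t <= 1 ->
  bernstein_region rho (RtoC y + RtoC t * (ellipse rho th - RtoC y))%C.
Proof.
intros Hr Hy Ht. apply bernstein_region_intro; [easy|].
pose proof (ellipse_a_gt1 rho Hr) as Ha.
assert (Hb : 0 < (rho - / rho) / 2).
{ assert (/ rho < 1) by (rewrite <- Rinv_1; apply Rinv_lt_contravar; lra). lra. }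
pose proof (sin2_cos2 th) as Hcs. unfold Rsqr in Hcs.
unfold ellipse. set (a := (rho + / rho) / 2) in *. set (b := (rho - / rho) / 2) in *.
set (c := cos th) in *. set (s := sin th) in *. simpl Re; simpl Im.
set (v := y / a). assert (Hv : v ^ 2 <= 1).
{ assert (-1 <= v <= 1); [|nra]. unfold v. split; [apply Rle_div_r; lra|apply Rle_div_l; lra]. }
match goal with |- ?X ^ 2 + ?Y ^ 2 <= 1 =>
  replace X with ((1 - t) * v + t * c) by (unfold v; field; lra);
  replace Y with (t * s) by (field; lra) end.
assert (Hc : c ^ 2 <= 1) by nra.
assert (Es : s ^ 2 = 1 - c ^ 2) by lra.
replace (((1 - t) * v + t * c) ^ 2 + (t * s) ^ 2) with
  ((1 - t) ^ 2 * v ^ 2 + 2 * ((1 - t) * t) * (v * c) + t ^ 2 * c ^ 2 + t ^ 2 * s ^ 2) by ring.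
rewrite Es.
assert (v * c <= 1) by (pose proof (pow2_ge_0 (v - c)); nra).
assert (0 <= (1 - t) * t) by nra.
assert ((1 - t) ^ 2 * v ^ 2 <= (1 - t) ^ 2) by (pose proof (pow2_ge_0 (1 - t)); nra).
nra.
Qed.

Lemma Ccont2_trig a b f g x y :
  continuity f -> continuity g -> Ccont2 (fun _ s => (a * f s, b * g s)) x y.
Proof.
intros Hf Hg. split; (apply continuity_2d_pt_mult; [apply continuity_2d_pt_const|]).
- apply (continuity_1d_2d_pt_comp f (fun _ s => s)); [apply Hf|apply continuity_2d_pt_id2].
- apply (continuity_1d_2d_pt_comp g (fun _ s => s)); [apply Hg|apply continuity_2d_pt_id2].
Qed.

Lemma Ccont2_ellipse rho x y : Ccont2 (fun _ s => ellipse rho s) x y.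
Proof. apply Ccont2_trig; [exact continuity_cos|exact continuity_sin]. Qed.

Lemma Ccont2_ext F G x y : (forall u v, F u v = G u v) -> Ccont2 F x y -> Ccont2 G x y.
Proof.
intros E [H1 H2]. split; [apply (continuity_2d_pt_ext (fun u v => Re (F u v)))|
  apply (continuity_2d_pt_ext (fun u v => Im (F u v)))]; auto; intros u v; now rewrite E.
Qed.

Lemma Ccont2_ellipse' rho x y : Ccont2 (fun _ s => ellipse' rho s) x y.
Proof.
apply Ccont2_ext with (fun _ s => ((- ((rho + / rho) / 2)) * sin s, (rho - / rho) / 2 * cos s)).
- intros _ s. unfold ellipse'. f_equal. ring.
- apply Ccont2_trig; [exact continuity_sin|exact continuity_cos].
Qed.

Lemma Ccont2_fst x y : Ccont2 (fun u _ => RtoC u) x y.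
Proof. split; [exact (continuity_2d_pt_id1 x y)|exact (continuity_2d_pt_const x y 0)]. Qed.

Lemma is_Cderive_ellipse rho th : is_Cderive (ellipse rho) th (ellipse' rho th).
Proof. split; simpl; auto_derive; try easy; unfold ellipse'; simpl; ring. Qed.

Lemma is_Cderive_RtoC t : is_Cderive RtoC t 1%C.
Proof. split; [apply (is_derive_id t)|apply (is_derive_const 0 t)]. Qed.

Lemma ellipse_periodic rho : ellipse rho 0 = ellipse rho (2 * PI).
Proof. unfold ellipse. now rewrite cos_2PI, sin_2PI, cos_0, sin_0. Qed.

Lemma ellipse_avoids rho th y : 1 < rho -> -1 <= y <= 1 ->
  (ellipse rho th - RtoC y)%C <> 0%C.
Proof.
intros Hr Hy E. pose proof (ellipse_dist rho th y Hr Hy) as H.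
rewrite E, Cmod_0 in H. pose proof (ellipse_a_gt1 rho Hr). lra.
Qed.

(** The pull-back of dz/(z-y) to the parameter, without the factor 1/(2 pi i). *)
Definition ellipse_kernel (rho y th : R) : C :=
  (ellipse' rho th * / (ellipse rho th - RtoC y))%C.

Lemma Ccont2_ellipse_kernel rho y x th : 1 < rho -> -1 <= y <= 1 ->
  Ccont2 (fun _ s => ellipse_kernel rho y s) x th.
Proof.
intros Hr Hy. apply Ccont2_mult; [apply Ccont2_ellipse'|].
apply Ccont2_inv; [|now apply ellipse_avoids].
apply Ccont2_minus; [apply Ccont2_ellipse|apply Ccont2_const].
Qed.

Lemma analytic_C_derive f z : analytic_at f z -> strict_derive f z (C_derive f z).
Proof.
intros H. destruct (analytic_strict_derive f z H) as [l Hl].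
now rewrite (strict_derive_C_derive f z l Hl).
Qed.

(** The contour is contracted to [y] along the segments joining [y] to it. *)
Lemma cauchy_ellipse_aux rho f y : 1 < rho -> -1 <= y <= 1 ->
  (forall z, bernstein_region rho z -> analytic_at f z) ->
  CInt (fun th => f (ellipse rho th) * ellipse_kernel rho y th)%C =
  (f (RtoC y) * CInt (ellipse_kernel rho y))%C.
Proof.
intros Hr Hy Hf.
set (Z := fun t th => (RtoC y + RtoC t * (ellipse rho th - RtoC y))%C).
assert (HZ : forall t th, 0 <= t <= 1 -> strict_derive f (Z t th) (C_derive f (Z t th))).
{ intros t th Ht. now apply analytic_C_derive, Hf, bernstein_region_star. }
assert (CZ : forall t th, Ccont2 Z t th).
{ intros t th. apply Ccont2_plus; [apply Ccont2_const|].
  apply Ccont2_mult; [apply Ccont2_fst|].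
  apply Ccont2_minus; [apply Ccont2_ellipse|apply Ccont2_const]. }
rewrite <- CInt_scal by (intros th; now apply Ccont2_ellipse_kernel).
transitivity (CInt (fun th => f (Z 1 th) * ellipse_kernel rho y th)%C).
{ apply CInt_ext. intros th. do 2 f_equal. unfold Z. ring. }
transitivity (CInt (fun th => f (Z 0 th) * ellipse_kernel rho y th)%C).
2:{ apply CInt_ext. intros th. do 2 f_equal. unfold Z. ring. }
symmetry.
(* With Z = y + t(z-y), the t-derivative of f(Z) z'/(z-y) and the th-derivative of f(Z)/t are both
   f'(Z) z'. *)
apply (CInt_homotopy (fun t th => f (Z t th) * ellipse_kernel rho y th)%C
  (fun t th => C_derive f (Z t th) * ellipse' rho th)%C
  (fun t th => f (Z t th) * RtoC (/ t))%C).
- intros t th Ht. apply Ccont2_mult; [|now apply Ccont2_ellipse_kernel].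
  apply Ccont2_comp; [|apply CZ]. exact (strict_derive_continuous _ _ _ (HZ t th Ht)).
- intros t th Ht. apply Ccont2_mult; [|apply Ccont2_ellipse'].
  apply Ccont2_Cmod. intros eps Heps.
  destruct (strict_derive_close f (Z t th) _ (HZ t th ltac:(lra)) eps Heps) as (d & Hd & Hs).
  pose proof (proj1 (Ccont2_Cmod Z t th) (CZ t th) d Hd) as [d' Hd'].
  (* The radius min(t, 1-t) keeps the first variable in [0,1], so that [Z] stays where f is
     analytic. *)
  assert (Hm : 0 < Rmin d' (Rmin t (1 - t))).
  { repeat apply Rmin_pos; try lra. apply cond_pos. }
  exists (mkposreal _ Hm). simpl. intros u v Hu Hv.
  pose proof (Rmin_l d' (Rmin t (1 - t))). pose proof (Rmin_r d' (Rmin t (1 - t))).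
  pose proof (Rmin_l t (1 - t)). pose proof (Rmin_r t (1 - t)).
  apply (Hs (Z u v)); [apply Hd'; lra|]. apply HZ.
  apply Rabs_lt_between in Hu. lra.
- intros t th Ht.
  eapply is_Cderive_eq.
  { apply is_Cderive_mult; [|apply is_Cderive_const].
    apply (is_Cderive_comp f (fun s => Z s th)); [apply HZ; lra|].
    apply is_Cderive_plus; [apply is_Cderive_const|].
    apply is_Cderive_mult; [apply is_Cderive_RtoC|apply is_Cderive_const]. }
  unfold ellipse_kernel. field. now apply ellipse_avoids.
- intros t th Ht.
  eapply is_Cderive_eq.
  { apply is_Cderive_mult; [|apply is_Cderive_const].
    apply (is_Cderive_comp f (fun s => Z t s)); [apply HZ; lra|].
    apply is_Cderive_plus; [apply is_Cderive_const|].
    apply is_Cderive_mult; [apply is_Cderive_const|].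
    apply is_Cderive_plus; [apply is_Cderive_ellipse|apply is_Cderive_const]. }
  rewrite RtoC_inv by lra. field. apply RtoC_neq_0; lra.
- intros t _. unfold Z. now rewrite ellipse_periodic.
Qed.

(** [W t] interpolates between the circle of radius [rho/2] and the ellipse
    shifted by [-y]; logarithmic derivatives satisfy
    [d/dt (W_th/W) = d/dth (W_t/W)]. *)
Lemma winding_ellipse rho y : 1 < rho -> -1 <= y <= 1 ->
  CInt (ellipse_kernel rho y) = (0, 2 * PI).
Proof.
intros Hr Hy.
(* [A0] and [B0] are u/2 and 1/(2u) for u = rho e^(i th); [A1] and [B1] are their derivatives. *)
set (A0 := fun th => (rho / 2 * cos th, rho / 2 * sin th) : C).
set (A1 := fun th => (- (rho / 2) * sin th, rho / 2 * cos th) : C).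
set (B0 := fun th => (/ rho / 2 * cos th, - (/ rho / 2) * sin th) : C).
set (B1 := fun th => (- (/ rho / 2) * sin th, - (/ rho / 2) * cos th) : C).
assert (DA : forall th, is_Cderive A0 th (A1 th))
  by (intros th; split; simpl; auto_derive; try easy; simpl; ring).
assert (DB : forall th, is_Cderive B0 th (B1 th))
  by (intros th; split; simpl; auto_derive; try easy; simpl; ring).
assert (CA0 : forall t th, Ccont2 (fun _ s => A0 s) t th)
  by (intros; apply Ccont2_trig; [exact continuity_cos|exact continuity_sin]).
assert (CA1 : forall t th, Ccont2 (fun _ s => A1 s) t th)
  by (intros; apply Ccont2_trig; [exact continuity_sin|exact continuity_cos]).
assert (CB0 : forall t th, Ccont2 (fun _ s => B0 s) t th)
  by (intros; apply Ccont2_trig; [exact continuity_cos|exact continuity_sin]).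
assert (CB1 : forall t th, Ccont2 (fun _ s => B1 s) t th)
  by (intros; apply Ccont2_trig; [exact continuity_sin|exact continuity_cos]).
set (W := fun t th => (A0 th + RtoC t * (B0 th - RtoC y))%C).
set (Wth := fun t th => (A1 th + RtoC t * B1 th)%C).
set (Wt := fun th => (B0 th - RtoC y)%C).
(* A zero forces sin th = 0 through the imaginary part, then rho + t/rho = 2t|y| <= 2t. For t <= 1/2
   the right side is at most 1 < rho; for larger t, t(2 - 1/rho) <= 2 - 1/rho < rho. *)
assert (HW : forall t th, 0 <= t <= 1 -> W t th <> 0%C).
{ intros t th Ht E.
  assert (E1 : rho / 2 * cos th + t * (/ rho / 2 * cos th - y) = 0).
  { transitivity (Re (W t th)); [|now rewrite E]. simpl. ring. }
  assert (E2 : rho / 2 * sin th - t * (/ rho / 2) * sin th = 0).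
  { transitivity (Im (W t th)); [|now rewrite E]. simpl. ring. }
  assert (Hi : 0 < / rho < 1).
  { split; [apply Rinv_0_lt_compat; lra|].
    rewrite <- Rinv_1; apply Rinv_lt_contravar; lra. }
  assert (Hp : (rho - t * / rho) * sin th = 0) by lra.
  assert (Hs : sin th = 0).
  { apply Rmult_integral in Hp as [Hp|Hp]; [nra|exact Hp]. }
  pose proof (sin2_cos2 th) as Hcs. rewrite Hs in Hcs. unfold Rsqr in Hcs.
  assert (Hq : (rho + t * / rho) * cos th = 2 * t * y) by lra.
  assert (Hq2 : (rho + t * / rho) ^ 2 = (2 * t * y) ^ 2).
  { rewrite <- Hq, Rpow_mult_distr. replace (cos th ^ 2) with 1 by (simpl; lra). ring. }
  assert (Hrr : rho * / rho = 1) by (field; lra).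
  assert ((2 * t * y) ^ 2 <= (2 * t) ^ 2) by (rewrite Rpow_mult_distr; assert (y ^ 2 <= 1) by nra; pose proof (pow2_ge_0 (2 * t)); nra).
  assert ((rho + t * / rho) ^ 2 = rho ^ 2 + 2 * t + t ^ 2 * (/ rho) ^ 2).
  { transitivity (rho ^ 2 + 2 * t * (rho * / rho) + t ^ 2 * (/ rho) ^ 2); [ring|].
    rewrite Hrr. ring. }
  assert (0 <= t ^ 2 * (/ rho) ^ 2) by (apply Rmult_le_pos; apply pow2_ge_0).
  destruct (Rle_dec t (/ 2)) as [Ht2|Ht2]; [nra|].
  assert (2 * t < rho + t * / rho); [|nra].
  assert (t * (2 - / rho) <= 2 - / rho) by nra.
  assert (2 < rho + / rho) by (pose proof (ellipse_a_gt1 rho Hr); lra). lra. }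
assert (CW : forall t th, Ccont2 W t th).
{ intros t th. apply Ccont2_plus; [apply CA0|]. apply Ccont2_mult; [apply Ccont2_fst|].
  apply Ccont2_minus; [apply CB0|apply Ccont2_const]. }
assert (CWth : forall t th, Ccont2 Wth t th).
{ intros t th. apply Ccont2_plus; [apply CA1|]. apply Ccont2_mult; [apply Ccont2_fst|apply CB1]. }
assert (CWt : forall t th, Ccont2 (fun _ s => Wt s) t th).
{ intros t th. apply Ccont2_minus; [apply CB0|apply Ccont2_const]. }
assert (DWt : forall t th, is_Cderive (fun s => W s th) t (Wt th)).
{ intros t th. eapply is_Cderive_eq.
  - apply is_Cderive_plus; [apply is_Cderive_const|].
    apply is_Cderive_mult; [apply is_Cderive_RtoC|apply is_Cderive_const].
  - unfold Wt. ring. }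
assert (DWth : forall t th, is_Cderive (fun s => W t s) th (Wth t th)).
{ intros t th. eapply is_Cderive_eq.
  - apply is_Cderive_plus; [apply DA|].
    apply is_Cderive_mult; [apply is_Cderive_const|].
    apply is_Cderive_plus; [apply DB|apply is_Cderive_const].
  - unfold Wth. ring. }
transitivity (CInt (fun th => Wth 1 th * / W 1 th)%C).
{ apply CInt_ext. intros th. unfold ellipse_kernel. apply (f_equal2 Cmult).
  - unfold Wth, A1, B1, ellipse'. apply injective_projections; simpl; field; lra.
  - apply f_equal. unfold W, A0, B0, ellipse. apply injective_projections; simpl; field; lra. }
transitivity (CInt (fun th => Wth 0 th * / W 0 th)%C).
(* On a circle centred at 0 the logarithmic derivative is the constant i. *)
2:{ transitivity (CInt (fun _ => Ci)).
  - apply CInt_ext. intros th. specialize (HW 0 th ltac:(lra)).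
    replace (Wth 0 th) with (Ci * W 0 th)%C; [field; exact HW|].
    unfold Wth, W, A0, A1. apply injective_projections; simpl; ring.
  - unfold CInt. simpl. apply injective_projections; simpl.
    + rewrite (RInt_const (V := R_CompleteNormedModule)).
      change ((2 * PI - 0) * 0 = 0). ring.
    + rewrite (RInt_const (V := R_CompleteNormedModule)).
      change ((2 * PI - 0) * 1 = 2 * PI). ring. }
symmetry.
apply (CInt_homotopy (fun t th => Wth t th * / W t th)%C
  (fun t th => B1 th * / W t th - Wth t th * Wt th * (/ W t th * / W t th))%C
  (fun t th => Wt th * / W t th)%C).
- intros t th Ht. apply Ccont2_mult; [apply CWth|]. apply Ccont2_inv; [apply CW|now apply HW].
- intros t th Ht. assert (CI : Ccont2 (fun u v => / W u v)%C t th)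
    by (apply Ccont2_inv; [apply CW|apply HW; lra]).
  apply Ccont2_minus; apply Ccont2_mult; auto; apply Ccont2_mult; auto.
- intros t th Ht. eapply is_Cderive_eq.
  { apply is_Cderive_mult.
    - apply is_Cderive_plus; [apply is_Cderive_const|].
      apply is_Cderive_mult; [apply is_Cderive_RtoC|apply is_Cderive_const].
    - apply is_Cderive_inv; [apply DWt|apply HW; lra]. }
  unfold Wth. ring.
- intros t th Ht. eapply is_Cderive_eq.
  { apply is_Cderive_mult.
    - apply is_Cderive_plus; [apply DB|apply is_Cderive_const].
    - apply is_Cderive_inv; [apply DWth|apply HW; lra]. }
  unfold Wt. ring.
- intros t _. unfold Wt, W, A0, B0. now rewrite cos_2PI, sin_2PI, cos_0, sin_0.
Qed.

Lemma cauchy_ellipse rho f y : 1 < rho -> -1 <= y <= 1 ->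
  (forall z, bernstein_region rho z -> analytic_at f z) ->
  CInt (fun th => f (ellipse rho th) * ellipse_kernel rho y th)%C =
  (2 * PI * Ci * f (RtoC y))%C.
Proof.
intros Hr Hy Hf. rewrite cauchy_ellipse_aux by easy. rewrite winding_ellipse by easy.
rewrite Cmult_comm. f_equal. apply injective_projections; simpl; ring.
Qed.

(** * Polynomials and interpolation *)

Lemma poly_ext n p q : (forall z, p z = q z) -> is_poly_deg_le n p -> is_poly_deg_le n q.
Proof. intros E [c H]. exists c. intros z. now rewrite <- E. Qed.

Lemma poly_S n p : is_poly_deg_le n p -> is_poly_deg_le (S n) p.
Proof.
intros [c H]. exists (fun k => if (k <=? n)%nat then c k else 0%C). intros z.
rewrite H, Csum_S.
replace (S n <=? n)%nat with false by (symmetry; apply Nat.leb_gt; lia).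
rewrite Cmult_0_l, Cplus_0_r. apply Csum_ext. intros k Hk.
now rewrite (proj2 (Nat.leb_le k n) Hk).
Qed.

Lemma poly_add n p q : is_poly_deg_le n p -> is_poly_deg_le n q ->
  is_poly_deg_le n (fun z => p z + q z)%C.
Proof.
intros [c H] [d G]. exists (fun k => c k + d k)%C. intros z.
rewrite H, G, <- Csum_plus. apply Csum_ext. intros k _. ring.
Qed.

Lemma poly_scal n a p : is_poly_deg_le n p -> is_poly_deg_le n (fun z => a * p z)%C.
Proof.
intros [c H]. exists (fun k => a * c k)%C. intros z.
rewrite H, <- Csum_scal. apply Csum_ext. intros k _. ring.
Qed.

Lemma poly_mulX n p : is_poly_deg_le n p -> is_poly_deg_le (S n) (fun z => z * p z)%C.
Proof.
intros [c H]. exists (fun k => match k return C with O => 0%C | S k' => c k' end). intros z.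
rewrite H, Csum_shift, Cmult_0_l, Cplus_0_l, <- Csum_scal. apply Csum_ext.
intros k _. simpl Cpow. ring.
Qed.

Lemma poly_const a : is_poly_deg_le 0 (fun _ => a).
Proof. exists (fun _ => a). intros z. rewrite sum_O. simpl Cpow. ring. Qed.

Lemma poly_0_inv p : is_poly_deg_le 0 p -> exists a, forall z, p z = a.
Proof.
intros [c H]. exists (c 0%nat). intros z. rewrite H, sum_O. simpl Cpow. ring.
Qed.

Lemma poly_const_n n a : is_poly_deg_le n (fun _ => a).
Proof. induction n; [apply poly_const|now apply poly_S]. Qed.

Lemma Cpow_divided a k : exists h, is_poly_deg_le k h /\
  forall z, (Cpow z (S k) - Cpow a (S k) = (z - a) * h z)%C.
Proof.
induction k as [|k (h & Hh & E)].
- exists (fun _ => 1%C). split; [apply poly_const|]. intros z. simpl Cpow. ring.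
- exists (fun z => z * h z + Cpow a (S k))%C. split.
  + apply poly_add; [now apply poly_mulX|apply poly_const_n].
  + intros z. transitivity (z * (Cpow z (S k) - Cpow a (S k)) + (z - a) * Cpow a (S k))%C;
      [simpl Cpow; ring|]. rewrite E. ring.
Qed.

Lemma poly_synthetic n p a : is_poly_deg_le (S n) p -> exists q, is_poly_deg_le n q /\
  forall z, p z = (p a + (z - a) * q z)%C.
Proof.
intros [c H].
enough (Hq : exists q, is_poly_deg_le n q /\ forall z,
  sum_n (fun k => c k * Cpow z k)%C (S n) =
  (sum_n (fun k => c k * Cpow a k)%C (S n) + (z - a) * q z)%C :> C).
{ destruct Hq as (q & Hq & E). exists q. split; [easy|]. intros z. now rewrite !H, E. }
clear H p. induction n as [|n (q & Hq & E)].
- exists (fun _ => c 1%nat). split; [apply poly_const|]. intros z.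
  rewrite !Csum_S, !sum_O. simpl Cpow. ring.
- destruct (Cpow_divided a (S n)) as (h & Hh & Eh).
  exists (fun z => q z + c (S (S n)) * h z)%C. split.
  + apply poly_add; [now apply poly_S|now apply poly_scal].
  + intros z. rewrite Csum_S, E, (Csum_S (fun k => (c k * Cpow a k)%C) (S n)).
    set (s := sum_n (fun k => (c k * Cpow a k)%C) (S n) : C).
    specialize (Eh z). set (u := Cpow z (S (S n))) in *. set (v := Cpow a (S (S n))) in *.
    replace u with ((u - v) + v)%C by ring. rewrite Eh. ring.
Qed.

Fixpoint node_poly (x : nat -> R) (k : nat) (z : C) : C :=
  match k with
  | O => 1%C
  | S k' => (node_poly x k' z * (z - RtoC (x k')))%C
  end.

Lemma node_poly_deg x k : is_poly_deg_le k (node_poly x k).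
Proof.
induction k as [|k IH]; [apply poly_const|].
apply poly_ext with (fun z => z * node_poly x k z + - RtoC (x k) * node_poly x k z)%C.
- intros z. simpl node_poly. ring.
- apply poly_add; [now apply poly_mulX|now apply poly_S, poly_scal].
Qed.

Lemma node_poly_neq_0 x k z : (forall j, (j < k)%nat -> z <> RtoC (x j)) ->
  node_poly x k z <> 0%C.
Proof.
induction k as [|k IH]; intros H.
- intros E. injection E. lra.
- simpl node_poly. apply Cmult_neq_0; [apply IH; auto|].
  intros E. apply (H k (Nat.lt_succ_diag_r k)).
  replace z with ((z - RtoC (x k)) + RtoC (x k))%C by ring. rewrite E. ring.
Qed.

Lemma node_poly_zero x k j : (j < k)%nat -> node_poly x k (RtoC (x j)) = 0%C.
Proof.
induction k as [|k IH]; intros Hj; [lia|]. simpl node_poly.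
destruct (Nat.eq_dec j k) as [->|Hne]; [ring|].
rewrite IH by lia. ring.
Qed.

(** Nodes are split off one at a time. The degree [m] of the quotient must stay general: with one
    node fewer removed it is m+1, and injectivity allows cancelling the product at the next node. *)
Lemma poly_factor x k m p :
  (forall i j, (i < k)%nat -> (j < k)%nat -> x i = x j -> i = j) ->
  is_poly_deg_le (k + m) p -> (forall j, (j < k)%nat -> p (RtoC (x j)) = 0%C) ->
  exists q, is_poly_deg_le m q /\ forall z, p z = (node_poly x k z * q z)%C.
Proof.
revert m. induction k as [|k IH]; intros m Hinj Hp H0.
- exists p. split; [exact Hp|]. intros z. simpl node_poly. ring.
- destruct (IH (S m)) as (q & Hq & E).
  + intros i j Hi Hj. apply Hinj; lia.
  + now replace (k + S m)%nat with (S k + m)%nat by lia.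
  + intros j Hj. apply H0. lia.
  + destruct (poly_synthetic m q (RtoC (x k)) Hq) as (r & Hr & Er).
    exists r. split; [exact Hr|]. intros z.
    assert (Hqk : q (RtoC (x k)) = 0%C).
    { pose proof (H0 k ltac:(lia)) as Hk. rewrite E in Hk.
      assert (Hn : node_poly x k (RtoC (x k)) <> 0%C).
      { apply node_poly_neq_0. intros j Hj Ex. injection Ex as Ex.
        apply Hinj in Ex; lia. }
      replace (q (RtoC (x k))) with (/ node_poly x k (RtoC (x k)) *
        (node_poly x k (RtoC (x k)) * q (RtoC (x k))))%C by (field; exact Hn).
      rewrite Hk. ring. }
    rewrite E, Er, Hqk. simpl node_poly. ring.
Qed.

Lemma poly_roots_zero x n p :
  (forall i j, (i <= n)%nat -> (j <= n)%nat -> x i = x j -> i = j) ->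
  is_poly_deg_le n p -> (forall j, (j <= n)%nat -> p (RtoC (x j)) = 0%C) ->
  forall z, p z = 0%C.
Proof.
intros Hinj Hp H0 z.
(* Only the first n nodes are factored out; the quotient is a constant, and the last node [x n]
   makes it 0. *)
destruct (poly_factor x n 0 p) as (q & Hq & E).
- intros i j Hi Hj. apply Hinj; lia.
- now rewrite Nat.add_0_r.
- intros j Hj. apply H0. lia.
- destruct (poly_0_inv q Hq) as [a Ha].
  pose proof (H0 n (le_n n)) as Hn. rewrite E, Ha in Hn.
  assert (Hne : node_poly x n (RtoC (x n)) <> 0%C).
  { apply node_poly_neq_0. intros j Hj Ex. injection Ex as Ex. apply Hinj in Ex; lia. }
  assert (Ea : a = 0%C).
  { replace a with (/ node_poly x n (RtoC (x n)) * (node_poly x n (RtoC (x n)) * a))%C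
      by (field; exact Hne). rewrite Hn. ring. }
  rewrite E, Ha, Ea. ring.
Qed.

Lemma poly_strict_derive n p z : is_poly_deg_le n p -> exists l, strict_derive p z l.
Proof.
revert p. induction n as [|n IH]; intros p Hp.
- destruct (poly_0_inv p Hp) as [a Ha]. exists 0%C.
  intros eps Heps. destruct (strict_derive_const a z eps Heps) as (d & Hd & H).
  exists d. split; [exact Hd|]. intros z1 z2. rewrite !Ha. apply H.
- destruct (poly_synthetic n p 0%C Hp) as (q & Hq & E).
  destruct (IH q Hq) as [l Hl].
  exists (0 + (q z + z * l))%C. intros eps Heps.
  destruct (strict_derive_plus _ _ z _ _ (strict_derive_const (p 0%C) z)
    (strict_derive_id_mult q z l Hl) eps Heps) as (d & Hd & H).
  exists d. split; [exact Hd|]. intros z1 z2 H1 H2.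
  rewrite (E z1), (E z2).
  replace (z1 - 0)%C with z1 by ring. replace (z2 - 0)%C with z2 by ring. now apply H.
Qed.

Lemma legendreC_deg k : is_poly_deg_le k (legendreC k).
Proof.
induction k as [| |k IH1 IH2] using pair_ind.
- apply poly_const.
- apply poly_ext with (fun z => z * 1)%C; [intros z; simpl; ring|].
  exact (poly_mulX 0 _ (poly_const 1%C)).
- apply poly_ext with (fun z => ((2 * INR k + 3)%R / (INR k + 2)%R)%C * (z * legendreC (S k) z)
    + (- ((INR k + 1)%R / (INR k + 2)%R))%C * legendreC k z)%C.
  + intros z. rewrite legendreC_rec. pose proof (pos_INR k). field.
    apply RtoC_neq_0. lra.
  + apply poly_add; apply poly_scal; [now apply poly_mulX|now apply poly_S, poly_S].
Qed.

Lemma phiC_deg n : (1 <= n)%nat -> is_poly_deg_le (S n) (phiC n).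
Proof.
intros Hn. destruct n as [|m]; [lia|]. unfold phiC.
replace (S m + 1)%nat with (S (S m)) by lia. replace (S m - 1)%nat with m by lia.
apply poly_ext with (fun z => legendreC (S (S m)) z + (-1)%C * legendreC m z)%C.
- intros z. ring.
- apply poly_add; [apply legendreC_deg|].
  apply poly_scal, poly_S, poly_S, legendreC_deg.
Qed.

(** phi has degree at most n+1 and n+1 distinct zeros, so the quotient is constant; it is nonzero
    because phi(2) > 0. *)
Lemma phiC_factor n x : (1 <= n)%nat -> is_LGL_points n x ->
  exists c : C, c <> 0%C /\ forall z, phiC n z = (node_poly x (S n) z * c)%C.
Proof.
intros Hn [Hinj Hz].
destruct (poly_factor x (S n) 0 (phiC n)) as (q & Hq & E).
- intros i j Hi Hj. apply Hinj; lia.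
- rewrite Nat.add_0_r. now apply phiC_deg.
- intros j Hj. rewrite phiC_RtoC. apply f_equal, Hz. exists j. split; [lia|easy].
- destruct (poly_0_inv q Hq) as [c Hc]. exists c. split.
  + intros Ec. pose proof (phi_pos_gt1 n 2 Hn ltac:(lra)) as H2.
    pose proof (E (RtoC 2)) as E2. rewrite phiC_RtoC, Hc, Ec, Cmult_0_r in E2.
    injection E2. lra.
  + intros z. now rewrite E, Hc.
Qed.

Lemma LGL_points_in n x j : (1 <= n)%nat -> is_LGL_points n x -> (j <= n)%nat ->
  -1 <= x j <= 1.
Proof.
intros Hn [_ Hz] Hj. apply (phi_zero_bound n); [easy|]. apply Hz. now exists j.
Qed.

(** Factor by factor: each node is at distance at least a-1 from any point of the ellipse and at
    most a+1 from the vertex a. Exponentially lossy, but positive for every n. *)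
Lemma phiC_ellipse_lower rho n x th : 1 < rho -> (1 <= n)%nat -> is_LGL_points n x ->
  phi_LGL n ((rho + / rho) / 2)
    * (((rho + / rho) / 2 - 1) / ((rho + / rho) / 2 + 1)) ^ (S n)
  <= Cmod (phiC n (ellipse rho th)).
Proof.
intros Hr Hn Hx. pose proof (ellipse_a_gt1 rho Hr) as Ha.
destruct (phiC_factor n x Hn Hx) as (c & Hc & E).
set (a := (rho + / rho) / 2) in *.
assert (Hlow : forall k, (k <= S n)%nat -> (a - 1) ^ k <= Cmod (node_poly x k (ellipse rho th))).
{ induction k as [|k IH]; intros Hk; [simpl; rewrite Cmod_1; lra|].
  simpl node_poly. rewrite Cmod_mult. simpl pow. rewrite Rmult_comm.
  apply Rmult_le_compat; [apply pow_le; lra|lra|apply IH; lia|].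
  apply ellipse_dist; [easy|]. apply (LGL_points_in n x); auto; lia. }
assert (Hup : forall k, (k <= S n)%nat -> Cmod (node_poly x k (RtoC a)) <= (a + 1) ^ k).
{ induction k as [|k IH]; intros Hk; [simpl; rewrite Cmod_1; lra|].
  simpl node_poly. rewrite Cmod_mult. simpl pow. rewrite (Rmult_comm (a + 1)).
  apply Rmult_le_compat; [apply Cmod_ge_0|apply Cmod_ge_0|apply IH; lia|].
  rewrite <- RtoC_minus, Cmod_R.
  pose proof (LGL_points_in n x k Hn Hx ltac:(lia)). apply Rabs_le. lra. }
assert (Ea : phi_LGL n a = Cmod (node_poly x (S n) (RtoC a)) * Cmod c).
{ rewrite <- Cmod_mult, <- E, phiC_RtoC, Cmod_R, Rabs_pos_eq; [easy|].
  apply Rlt_le. now apply phi_pos_gt1. }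
rewrite Ea, E, Cmod_mult. specialize (Hlow (S n) (le_n _)). specialize (Hup (S n) (le_n _)).
set (U := Cmod (node_poly x (S n) (RtoC a))) in *.
set (V := Cmod (node_poly x (S n) (ellipse rho th))) in *.
unfold Rdiv. rewrite Rpow_mult_distr, pow_inv.
assert (Hp : 0 < (a + 1) ^ S n) by (apply pow_lt; lra).
assert (Hp' : 0 < (a - 1) ^ S n) by (apply pow_lt; lra).
pose proof (Cmod_ge_0 c).
apply Rle_trans with ((a + 1) ^ S n * Cmod c * ((a - 1) ^ S n * / (a + 1) ^ S n)).
- apply Rmult_le_compat_r.
  + apply Rmult_le_pos; [lra|]. apply Rlt_le, Rinv_0_lt_compat, Hp.
  + now apply Rmult_le_compat_r.
- replace ((a + 1) ^ S n * Cmod c * ((a - 1) ^ S n * / (a + 1) ^ S n))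
    with ((a - 1) ^ S n * Cmod c) by (field; lra).
  now apply Rmult_le_compat_r.
Qed.

Lemma node_poly_ellipse_neq_0 rho x k th : 1 < rho ->
  (forall j, (j < k)%nat -> -1 <= x j <= 1) -> node_poly x k (ellipse rho th) <> 0%C.
Proof.
intros Hr Hx. apply node_poly_neq_0. intros j Hj E.
apply (ellipse_avoids rho th (x j) Hr (Hx j Hj)). rewrite E. ring.
Qed.

Lemma Ccont2_node_poly rho x k t th : Ccont2 (fun _ s => node_poly x k (ellipse rho s)) t th.
Proof.
induction k as [|k IH]; [exact (Ccont2_const 1%C t th)|]. simpl node_poly.
apply Ccont2_mult; [exact IH|].
apply Ccont2_minus; [apply Ccont2_ellipse|apply Ccont2_const].
Qed.

(** Newton's form of the interpolation remainder, from iterating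
    [1/(z-y) = 1/(z-x_k) + (y-x_k)/((z-x_k)(z-y))] under the integral. *)
Lemma newton_remainder rho F x n : 1 < rho -> Ccont F ->
  (forall j, (j <= n)%nat -> -1 <= x j <= 1) ->
  exists N, is_poly_deg_le n N /\ forall y, -1 <= y <= 1 ->
    CInt (fun th => F th * ellipse_kernel rho y th)%C =
    (N (RtoC y) + node_poly x (S n) (RtoC y) *
      CInt (fun th => F th * ellipse_kernel rho y th * / node_poly x (S n) (ellipse rho th)))%C.
Proof.
intros Hr HF Hx.
assert (HC : forall k y, (k <= S n)%nat -> -1 <= y <= 1 ->
  Ccont (fun th => F th * ellipse_kernel rho y th * / node_poly x k (ellipse rho th))%C).
{ intros k y Hk Hy th. apply Ccont2_mult; [apply Ccont2_mult; [apply HF|now apply Ccont2_ellipse_kernel]|].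
  apply Ccont2_inv; [apply Ccont2_node_poly|].
  apply node_poly_ellipse_neq_0; [easy|]. intros j Hj. apply Hx. lia. }
assert (Step : forall k, (k <= n)%nat -> forall y, -1 <= y <= 1 ->
  CInt (fun th => F th * ellipse_kernel rho y th * / node_poly x k (ellipse rho th))%C =
  (CInt (fun th => F th * ellipse_kernel rho (x k) th * / node_poly x k (ellipse rho th))
   + (RtoC y - RtoC (x k)) *
     CInt (fun th => F th * ellipse_kernel rho y th * / node_poly x (S k) (ellipse rho th)))%C).
{ intros k Hk y Hy. rewrite <- CInt_scal by (apply HC; [lia|easy]).
  rewrite <- CInt_plus; [|apply HC; [lia|now apply Hx]|].
  2:{ intros th. apply Ccont2_mult; [apply Ccont2_const|]. apply HC; [lia|easy]. }
  apply CInt_ext. intros th. unfold ellipse_kernel. simpl node_poly.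
  pose proof (ellipse_avoids rho th y Hr Hy). pose proof (ellipse_avoids rho th (x k) Hr (Hx k Hk)).
  assert (node_poly x k (ellipse rho th) <> 0%C)
    by (apply node_poly_ellipse_neq_0; [easy|]; intros j Hj; apply Hx; lia).
  field. auto. }
assert (Main : forall k, (k <= n)%nat -> exists N, is_poly_deg_le k N /\ forall y, -1 <= y <= 1 ->
    CInt (fun th => F th * ellipse_kernel rho y th)%C =
    (N (RtoC y) + node_poly x (S k) (RtoC y) *
      CInt (fun th => F th * ellipse_kernel rho y th * / node_poly x (S k) (ellipse rho th)))%C).
{ induction k as [|k IH]; intros Hk.
  - exists (fun _ => CInt (fun th => F th * ellipse_kernel rho (x 0%nat) th * / node_poly x 0 (ellipse rho th))%C).
    split; [apply poly_const|]. intros y Hy.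
    transitivity (CInt (fun th => F th * ellipse_kernel rho y th * / node_poly x 0 (ellipse rho th))%C).
    + apply CInt_ext. intros th. simpl node_poly. field.
    + rewrite (Step 0%nat Hk y Hy). apply (f_equal2 Cplus); [reflexivity|].
      apply (f_equal2 Cmult); [|reflexivity]. simpl node_poly. ring.
  - destruct (IH ltac:(lia)) as (N & HN & E).
    (* The new coefficient integrates F dz over the product of the z - x_i, i <= k+1: for analytic
       data, 2 pi i times a divided difference. *)
    exists (fun z => N z + CInt (fun th => F th * ellipse_kernel rho (x (S k)) th
       * / node_poly x (S k) (ellipse rho th)) * node_poly x (S k) z)%C.
    split; [apply poly_add; [now apply poly_S|apply poly_scal, node_poly_deg]|].
    intros y Hy. rewrite (E y Hy), (Step (S k) Hk y Hy).
    change (node_poly x (S (S k)) (RtoC y))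
      with (node_poly x (S k) (RtoC y) * (RtoC y - RtoC (x (S k))))%C. ring. }
now apply Main.
Qed.

(** * Error bounds *)

Lemma bernstein_ellipse_intro rho th : 0 < rho -> bernstein_ellipse rho (ellipse rho th).
Proof.
intros Hr. destruct (angle_exists (cos th) (sin th)) as (s & Hs & Ec & Es).
{ pose proof (sin2_cos2 th) as H. unfold Rsqr in H. simpl. lra. }
exists s. split; [easy|].
destruct (ellipse_joukowski rho s Hr) as (_ & _ & ->). unfold ellipse. now rewrite Ec, Es.
Qed.

Lemma L_ellipse_eq rho : 0 < rho ->
  L_ellipse rho = RInt (fun th => Cmod (ellipse' rho th)) 0 (2 * PI).
Proof.
intros Hr. unfold L_ellipse, curve_length. apply RInt_ext. intros th _. f_equal.
assert (E : forall s, ellipse rho s = bernstein_param rho s).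
{ intros s. symmetry. now apply ellipse_joukowski. }
destruct (is_Cderive_ext _ _ _ _ E (is_Cderive_ellipse rho th)) as [H1 H2].
rewrite (surjective_pairing (ellipse' rho th)).
apply (f_equal2 pair); now apply is_derive_unique.
Qed.

Lemma Ccont_Cmod F th : Ccont F -> continuous (fun s => Cmod (F s)) th.
Proof.
intros HF. apply filterlim_locally. intros [eps Heps].
pose proof (proj1 (Ccont2_Cmod _ 0 th) (HF th) eps Heps) as HL.
apply locally_2d_1d_const_x in HL. revert HL. apply filter_imp. intros s Hs.
change (Rabs (Cmod (F s) - Cmod (F th)) < eps).
eapply Rle_lt_trans; [|exact Hs].
pose proof (Cmod_triangle (F s - F th) (F th)) as T1.
pose proof (Cmod_triangle (F th - F s) (F s)) as T2.
replace (F s - F th + F th)%C with (F s) in T1 by ring.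
replace (F th - F s + F s)%C with (F th) in T2 by ring.
replace (F th - F s)%C with (- (F s - F th))%C in T2 by ring. rewrite Cmod_opp in T2.
apply Rabs_le. lra.
Qed.

Lemma analytic_Ccont rho f : 1 < rho ->
  (forall z, bernstein_region rho z -> analytic_at f z) ->
  Ccont (fun th => f (ellipse rho th)).
Proof.
intros Hr Hf th. apply (Ccont2_comp f (fun _ s => ellipse rho s)); [|apply Ccont2_ellipse].
apply (strict_derive_continuous f _ (C_derive f (ellipse rho th))).
apply analytic_C_derive, Hf.
replace (ellipse rho th) with (RtoC 0 + RtoC 1 * (ellipse rho th - RtoC 0))%C by ring.
apply bernstein_region_star; lra.
Qed.

(** [real] sends an infinite supremum to 0, so finiteness must be shown first; it comes from the
    maximum of a continuous function on [0, 2 pi]. *)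
Lemma M_ellipse_bound rho f th : 1 < rho ->
  (forall z, bernstein_region rho z -> analytic_at f z) ->
  Cmod (f (ellipse rho th)) <= M_ellipse f rho.
Proof.
intros Hr Hf. pose proof (analytic_Ccont rho f Hr Hf) as HC. pose proof PI_RGT_0.
destruct (continuity_ab_maj (fun s => Cmod (f (ellipse rho s))) 0 (2 * PI)) as (m & Hm & _); [lra| |].
{ intros s _. apply continuity_pt_filterlim. now apply (Ccont_Cmod (fun th => f (ellipse rho th))). }
unfold M_ellipse, sup_norm.
set (S := fun y => exists z, bernstein_ellipse rho z /\ y = Cmod (f z)).
destruct (Lub_Rbar_correct S) as [Hub Hlub].
assert (Hle : Rbar_le (Lub_Rbar S) (Finite (Cmod (f (ellipse rho m))))).
{ apply Hlub. intros y (z & (s & Hs & ->) & ->). simpl.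
  destruct (ellipse_joukowski rho s ltac:(lra)) as (_ & _ & ->). apply Hm. lra. }
assert (Hge : Rbar_le (Finite (Cmod (f (ellipse rho th)))) (Lub_Rbar S)).
{ apply Hub. exists (ellipse rho th). split; [|easy]. apply bernstein_ellipse_intro. lra. }
destruct (Lub_Rbar S); simpl in *; try easy; lra.
Qed.

(** Here too the infimum must be finite for [real] to be meaningful; it lies between a-1 > 0 and any
    attained distance. *)
Lemma set_dist_ellipse rho : 1 < rho ->
  0 < set_dist Omega (bernstein_ellipse rho) /\
  forall y th, -1 <= y <= 1 ->
    set_dist Omega (bernstein_ellipse rho) <= Cmod (ellipse rho th - RtoC y).
Proof.
intros Hr. unfold set_dist.
set (S := fun d => exists z w : C, Omega z /\ bernstein_ellipse rho w /\ d = Cmod (z - w)).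
destruct (Glb_Rbar_correct S) as [Hlb Hglb].
assert (Hsym : forall z w : C, Cmod (z - w) = Cmod (w - z)).
{ intros z w. rewrite <- Cmod_opp. f_equal. ring. }
assert (Hin : forall y th, -1 <= y <= 1 -> S (Cmod (ellipse rho th - RtoC y))).
{ intros y th Hy. exists (RtoC y), (ellipse rho th).
  split; [now exists y|]. split; [apply bernstein_ellipse_intro; lra|apply Hsym]. }
pose proof (ellipse_a_gt1 rho Hr) as Ha.
assert (Hge : Rbar_le (Finite ((rho + / rho) / 2 - 1)) (Glb_Rbar S)).
{ apply Hglb. intros d (z & w & (y & Hy & ->) & (s & Hs & ->) & ->).
  destruct (ellipse_joukowski rho s ltac:(lra)) as (_ & _ & ->).
  rewrite Hsym. now apply ellipse_dist. }
pose proof (Hlb _ (Hin 0 0 ltac:(lra))) as H0.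
destruct (Glb_Rbar S) as [d| |] eqn:Ed; simpl in *; try easy.
split; [lra|]. intros y th Hy. exact (Hlb _ (Hin y th Hy)).
Qed.

Lemma interpolation_error rho f n x p m : 1 < rho ->
  (forall z, bernstein_region rho z -> analytic_at f z) ->
  (1 <= n)%nat -> is_LGL_points n x -> is_poly_deg_le n p ->
  (forall j, (j <= n)%nat -> p (RtoC (x j)) = f (RtoC (x j))) ->
  0 < m -> (forall th, m <= Cmod (phiC n (ellipse rho th))) ->
  forall y, -1 <= y <= 1 -> Cmod (f (RtoC y) - p (RtoC y)) <=
    M_ellipse f rho * L_ellipse rho
      / (2 * PI * set_dist Omega (bernstein_ellipse rho) * m) * Rabs (phi_LGL n y).
Proof.
intros Hr Hf Hn Hx Hp Hpf Hm Hphi y Hy.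
destruct (phiC_factor n x Hn Hx) as (c & Hc & Ec).
destruct (set_dist_ellipse rho Hr) as [Hd0 Hd].
set (d := set_dist Omega (bernstein_ellipse rho)) in *.
set (M := M_ellipse f rho).
assert (HM : forall th, Cmod (f (ellipse rho th)) <= M) by (intros; now apply M_ellipse_bound).
pose proof PI_RGT_0 as Hpi.
assert (Hxi : forall j, (j <= n)%nat -> -1 <= x j <= 1)
  by (intros; now apply (LGL_points_in n x)).
assert (HF := analytic_Ccont rho f Hr Hf).
destruct (newton_remainder rho _ x n Hr HF Hxi) as (N & HN & E).
set (R0 := CInt (fun th => f (ellipse rho th) * ellipse_kernel rho y th
   * / node_poly x (S n) (ellipse rho th))%C).
set (k := (2 * PI * Ci)%C).
assert (Hk : Cmod k = 2 * PI).
{ unfold k. rewrite !Cmod_mult, Cmod_Ci.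
  rewrite !Cmod_R, !Rabs_pos_eq by lra. ring. }
(* At a node the remainder vanishes, so the Newton part N equals 2 pi i f = 2 pi i p there; with n+1
   nodes and degree at most n, N is 2 pi i p everywhere. *)
assert (EN : forall z, (N z + - k * p z)%C = 0%C).
{ apply (poly_roots_zero x n); [apply Hx|apply poly_add; [easy|now apply poly_scal]|].
  intros j Hj. rewrite Hpf by easy.
  pose proof (E (x j) (Hxi j Hj)) as Ej.
  rewrite node_poly_zero, Cmult_0_l, Cplus_0_r in Ej by lia.
  rewrite <- Ej, cauchy_ellipse by auto. fold k. ring. }
assert (Ek : (k * (f (RtoC y) - p (RtoC y)) = node_poly x (S n) (RtoC y) * R0)%C).
{ pose proof (E y Hy) as Ey. rewrite cauchy_ellipse in Ey by auto. fold k R0 in Ey.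
  transitivity ((N (RtoC y) + - k * p (RtoC y)) + node_poly x (S n) (RtoC y) * R0)%C.
  - transitivity (k * f (RtoC y) - k * p (RtoC y))%C; [ring|]. rewrite Ey. ring.
  - rewrite EN. ring. }
assert (HL : ex_RInt (fun th => Cmod (ellipse' rho th)) 0 (2 * PI)).
{ apply (ex_RInt_continuous (V := R_CompleteNormedModule)). intros th _.
  apply (Ccont_Cmod (ellipse' rho)). intros s. apply Ccont2_ellipse'. }
assert (Hc0 : 0 < Cmod c) by now apply Cmod_gt_0.
assert (HR0 : Cmod R0 <= M * Cmod c / (d * m) * L_ellipse rho).
{ rewrite L_ellipse_eq by lra. apply CInt_bound; [|exact HL|].
  - intros th. apply Ccont2_mult; [apply Ccont2_mult; [apply HF|now apply Ccont2_ellipse_kernel]|].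
    apply Ccont2_inv; [apply Ccont2_node_poly|].
    apply node_poly_ellipse_neq_0; [easy|]. intros j Hj. apply Hxi. lia.
  - intros th. unfold ellipse_kernel.
    assert (Hn0 : node_poly x (S n) (ellipse rho th) <> 0%C)
      by (apply node_poly_ellipse_neq_0; [easy|]; intros j Hj; apply Hxi; lia).
    rewrite !Cmod_mult, !Cmod_inv by (try exact Hn0; now apply ellipse_avoids).
    specialize (Hphi th). rewrite Ec, Cmod_mult in Hphi.
    specialize (HM th). specialize (Hd y th Hy).
    set (D := Cmod (ellipse rho th - RtoC y)) in *.
    set (W := Cmod (node_poly x (S n) (ellipse rho th))) in *.
    assert (HW : 0 < W) by now apply Cmod_gt_0.
    pose proof (Cmod_ge_0 (f (ellipse rho th))). pose proof (Cmod_ge_0 (ellipse' rho th)) as Hw'.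
    (* From m <= |phi| = W |c|. The unknown |c| later merges with the node product at y into
       |phi(y)|. *)
    assert (HiW : / W <= Cmod c / m).
    { apply Rle_trans with (Cmod c / (W * Cmod c)); [right; field; lra|].
      apply Rmult_le_compat_l; [lra|]. apply Rinv_le_contravar; lra. }
    assert (HiD : / D <= / d) by (apply Rinv_le_contravar; lra).
    replace (Cmod (f (ellipse rho th)) * (Cmod (ellipse' rho th) * / D) * / W)
      with ((Cmod (f (ellipse rho th)) * (/ D * / W)) * Cmod (ellipse' rho th)) by ring.
    apply Rmult_le_compat_r; [easy|].
    replace (M * Cmod c / (d * m)) with (M * (/ d * (Cmod c / m))) by (field; lra).
    assert (0 < / D) by (apply Rinv_0_lt_compat; lra).
    assert (0 < / W) by now apply Rinv_0_lt_compat.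
    apply Rmult_le_compat; [easy|nra|easy|]. apply Rmult_le_compat; lra. }
assert (Eph : Rabs (phi_LGL n y) = Cmod (node_poly x (S n) (RtoC y)) * Cmod c).
{ rewrite <- Cmod_mult, <- Ec, phiC_RtoC. now rewrite Cmod_R. }
apply (f_equal Cmod) in Ek. rewrite !Cmod_mult, Hk in Ek. rewrite Eph.
set (U := Cmod (node_poly x (S n) (RtoC y))) in *.
assert (HU : 0 <= U) by apply Cmod_ge_0.
apply Rmult_le_reg_l with (2 * PI); [lra|]. rewrite Ek.
replace (2 * PI * (M * L_ellipse rho / (2 * PI * d * m) * (U * Cmod c)))
  with (U * (M * Cmod c / (d * m) * L_ellipse rho)) by (field; lra).
now apply Rmult_le_compat_l.
Qed.

(** Both functions vanish at x0, so the domination passes to difference quotients and then to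
    derivatives. *)
Lemma derive_le_of_domin e (g : R -> R) l g' B x0 :
  strict_derive e (RtoC x0) l -> is_derive g x0 g' -> 0 <= B ->
  -1 <= x0 <= 1 -> e (RtoC x0) = 0%C -> g x0 = 0 ->
  (forall y, -1 <= y <= 1 -> Cmod (e (RtoC y)) <= B * Rabs (g y)) ->
  Cmod l <= B * Rabs g'.
Proof.
intros He Hg HB Hx He0 Hg0 Hdom. apply le_epsilon. intros eps Heps.
destruct (He (eps / 2) ltac:(lra)) as (d1 & Hd1 & H1).
destruct (proj1 (is_derive_eps g x0 g') Hg (eps / (2 * (1 + B)))) as (d2 & Hd2 & H2).
{ apply Rdiv_lt_0_compat; lra. }
set (h := Rmin (/ 2) (Rmin d1 d2 / 2)).
assert (Hm : 0 < Rmin d1 d2) by now apply Rmin_pos.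
pose proof (Rmin_l d1 d2). pose proof (Rmin_r d1 d2).
assert (Hh : 0 < h) by (apply Rmin_pos; lra).
assert (Hh1 : h <= / 2) by apply Rmin_l.
assert (Hh2 : h <= Rmin d1 d2 / 2) by apply Rmin_r.
(* The step goes towards the interior: domination holds only on [-1,1], and x0 may be an
   endpoint. *)
assert (exists y, -1 <= y <= 1 /\ Rabs (y - x0) = h) as (y & Hy & Hyx).
{ destruct (Rle_dec x0 0).
  - exists (x0 + h). split; [lra|]. replace (x0 + h - x0) with h by ring. apply Rabs_pos_eq; lra.
  - exists (x0 - h). split; [lra|]. replace (x0 - h - x0) with (- h) by ring.
    rewrite Rabs_Ropp. apply Rabs_pos_eq; lra. }
assert (Ey : Cmod (RtoC y - RtoC x0) = h) by (now rewrite <- RtoC_minus, Cmod_R).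
specialize (H1 (RtoC y) (RtoC x0)). rewrite Ey, He0 in H1.
replace (RtoC x0 - RtoC x0)%C with (RtoC 0) in H1 by ring. rewrite Cmod_0 in H1.
specialize (H1 ltac:(lra) Hd1). specialize (H2 y ltac:(lra)).
rewrite Hg0, Hyx in H2. specialize (Hdom y Hy).
assert (T1 : Cmod l * h <= eps / 2 * h + Cmod (e (RtoC y))).
{ rewrite <- Ey at 1. rewrite <- Cmod_mult.
  replace (l * (RtoC y - RtoC x0))%C with
    (- (e (RtoC y) - 0 - l * (RtoC y - RtoC x0)) + e (RtoC y))%C by ring.
  eapply Rle_trans; [apply Cmod_triangle|]. rewrite Cmod_opp. lra. }
assert (T2 : Rabs (g y) <= (eps / (2 * (1 + B)) + Rabs g') * h).
{ replace (g y) with ((g y - 0 - g' * (y - x0)) + g' * (y - x0)) by ring.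
  eapply Rle_trans; [apply Rabs_triang|]. rewrite Rabs_mult, Hyx. lra. }
assert (T3 : B * (eps / (2 * (1 + B))) <= eps / 2).
{ apply Rle_trans with ((1 + B) * (eps / (2 * (1 + B)))); [|right; field; lra].
  apply Rmult_le_compat_r; [|lra]. apply Rlt_le, Rdiv_lt_0_compat; lra. }
apply Rmult_le_reg_r with h; [easy|].
apply Rle_trans with (eps / 2 * h + B * ((eps / (2 * (1 + B)) + Rabs g') * h)).
- eapply Rle_trans; [exact T1|]. apply Rplus_le_compat_l.
  eapply Rle_trans; [exact Hdom|]. now apply Rmult_le_compat_l.
- nra.
Qed.

Lemma interpolation_derive_error rho f n x p A : 1 < rho ->
  (forall z, bernstein_region rho z -> analytic_at f z) ->
  (1 <= n)%nat -> is_LGL_points n x -> is_poly_deg_le n p ->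
  (forall j, (j <= n)%nat -> p (RtoC (x j)) = f (RtoC (x j))) ->
  0 <= A ->
  (forall y, -1 <= y <= 1 -> Cmod (f (RtoC y) - p (RtoC y)) <= A * Rabs (phi_LGL n y)) ->
  forall j, (j <= n)%nat ->
    Cmod (C_derive f (RtoC (x j)) - C_derive p (RtoC (x j))) <= A * (2 * INR n + 1).
Proof.
intros Hr Hf Hn Hx Hp Hpf HA Hdom j Hj.
assert (Hxj : -1 <= x j <= 1) by now apply (LGL_points_in n x).
assert (Hreg : bernstein_region rho (RtoC (x j))).
{ replace (RtoC (x j)) with (RtoC (x j) + RtoC 0 * (ellipse rho 0 - RtoC (x j)))%C by ring.
  apply bernstein_region_star; lra. }
pose proof (analytic_C_derive f _ (Hf _ Hreg)) as Df.
destruct (poly_strict_derive n p (RtoC (x j)) Hp) as [l Dp].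
rewrite (strict_derive_C_derive p _ l Dp).
destruct (poly_strict_derive n (fun z => (-1) * p z)%C (RtoC (x j)) (poly_scal n _ p Hp)) as [l' Dp'].
(* By uniqueness of the derivative, since p + (-1) p is identically 0. *)
assert (El : l' = (- l)%C).
{ pose proof (strict_derive_plus _ _ _ _ _ Dp Dp') as Ds.
  assert (D0 : strict_derive (fun _ => 0%C) (RtoC (x j)) (l + l')%C).
  { intros eps Heps. destruct (Ds eps Heps) as (d & Hd & H). exists d. split; [easy|].
    intros z1 z2 H1 H2. specialize (H z1 z2 H1 H2). revert H.
    replace (p z1 + -1 * p z1 - (p z2 + -1 * p z2))%C with (0 - 0)%C by ring. auto. }
  apply strict_derive_C_derive in D0.
  rewrite (strict_derive_C_derive _ _ _ (strict_derive_const 0%C (RtoC (x j)))) in D0.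
  replace l' with ((l + l') - l)%C by ring. rewrite <- D0. ring. }
pose proof (strict_derive_plus _ _ _ _ _ Df Dp') as De. rewrite El in De.
eapply Rle_trans.
- apply (derive_le_of_domin _ (phi_LGL n) _ _ A (x j) De (is_derive_phi n (x j) Hn) HA Hxj).
  + rewrite Hpf by easy. ring.
  + apply Hx. now exists j.
  + intros y Hy. replace (f (RtoC y) + -1 * p (RtoC y))%C with (f (RtoC y) - p (RtoC y))%C by ring.
    now apply Hdom.
- apply Rmult_le_compat_l; [easy|].
  rewrite Rabs_mult. pose proof (pos_INR n). pose proof (legendre_bound n (x j) Hxj).
  rewrite Rabs_pos_eq by lra. nra.
Qed.

(** [phi_lower] gives the right asymptotics but can be negative for small [n]; the second
    bound keeps the minimum positive for every [n]. *)
Definition phi_min (rho : R) (n : nat) : R :=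
  Rmax (phi_lower rho n)
    (phi_LGL n ((rho + / rho) / 2)
     * (((rho + / rho) / 2 - 1) / ((rho + / rho) / 2 + 1)) ^ (S n)).

Lemma phi_min_pos rho n : 1 < rho -> (1 <= n)%nat -> 0 < phi_min rho n.
Proof.
intros Hr Hn. pose proof (ellipse_a_gt1 rho Hr) as Ha.
eapply Rlt_le_trans; [|apply Rmax_r].
apply Rmult_lt_0_compat; [now apply phi_pos_gt1|].
apply pow_lt, Rdiv_lt_0_compat; lra.
Qed.

Lemma phi_min_le rho n x th : 1 < rho -> (1 <= n)%nat -> is_LGL_points n x ->
  phi_min rho n <= Cmod (phiC n (ellipse rho th)).
Proof.
intros Hr Hn Hx. apply Rmax_lub.
- destruct (ellipse_joukowski rho th ltac:(lra)) as (Hu & Eu & <-). rewrite Eu.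
  apply phiC_ge_phi_lower; auto; lra.
- now apply (phiC_ellipse_lower rho n x).
Qed.

(** The second argument is exactly the quotient of the first bound obtained by the one claimed; 1 +
    1/(2n) is (2n+1)/(2n), from [phi_bound]. The maximum with 1 gives positivity for every n, even
    at n = 0 where the quotient has no meaning. *)
Definition bound_const (rho : R) (n : nat) : R :=
  Rmax 1 ((1 + / 2 * / INR n) * (cbin n * rho ^ n * sqrt (rho ^ 2 - 1)) / phi_min rho n).

(** Once [phi_lower] is positive it may replace [phi_min] in the denominator, which only increases
    the quotient. The result Y tends to 1, and the constant is squeezed between 1 and 1 + |Y -
    1|. *)
Lemma bound_const_lim rho : 1 < rho -> is_lim_seq (bound_const rho) 1.
Proof.
intros Hr. pose proof (phi_lower_asymp rho Hr) as HL.
set (s := sqrt (rho ^ 2 - 1)) in *.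
assert (Hs : 0 < s) by (apply sqrt_lt_R0; nra).
set (r := fun n => phi_lower rho n / (cbin n * rho ^ n)) in *.
set (Y := fun n => (1 + / 2 * / INR n) * (s * / r n)).
assert (HY : is_lim_seq Y 1).
{ replace (Finite 1) with (Finite ((1 + / 2 * 0) * (s * / s))) by (f_equal; field; lra).
  apply is_lim_seq_mult'; [apply is_lim_seq_plus'; [apply is_lim_seq_const|]|].
  - apply (is_lim_seq_scal_l (fun n => / INR n) (/ 2) 0).
    apply (is_lim_seq_inv _ p_infty); [apply is_lim_seq_INR|easy].
  - apply (is_lim_seq_scal_l (fun n => / r n) s (/ s)).
    apply (is_lim_seq_inv r s); [exact HL|]. intros E. injection E. lra. }
assert (Hr0 : eventually (fun n => 0 < r n)).
{ destruct (proj2 (is_lim_seq_spec r s) HL (mkposreal s Hs)) as [N HN].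
  exists N. intros n Hn. specialize (HN n Hn). simpl in HN.
  apply Rabs_lt_between in HN. lra. }
apply is_lim_seq_le_le_loc with (fun _ => 1) (fun n => 1 + Rabs (Y n - 1)).
- destruct Hr0 as [N HN]. exists (S N). intros n Hn. specialize (HN n ltac:(lia)).
  split; [apply Rmax_l|]. apply Rmax_lub; [pose proof (Rabs_pos (Y n - 1)); lra|].
  apply Rle_trans with (Y n); [|pose proof (Rle_abs (Y n - 1)); lra].
  assert (HI : 0 < INR n) by (apply lt_0_INR; lia).
  pose proof (cbin_pos n) as Hc. pose proof (pow_lt rho n ltac:(lra)) as Hp.
  assert (Hcp : 0 < cbin n * rho ^ n) by now apply Rmult_lt_0_compat.
  assert (Hlow : 0 < phi_lower rho n).
  { replace (phi_lower rho n) with (r n * (cbin n * rho ^ n)) by (unfold r; field; lra).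
    now apply Rmult_lt_0_compat. }
  unfold Y. replace (s * / r n) with (cbin n * rho ^ n * s / phi_lower rho n)
    by (unfold r; field; lra).
  unfold Rdiv. rewrite <- (Rmult_assoc _ _ (/ phi_lower rho n)). fold s.
  apply Rmult_le_compat_l.
  + apply Rmult_le_pos; [|apply Rmult_le_pos; lra].
    assert (0 < / INR n) by now apply Rinv_0_lt_compat. lra.
  + apply Rinv_le_contravar; [easy|]. apply Rmax_l.
- apply is_lim_seq_const.
- replace (Finite 1) with (Finite (1 + 0)) by (f_equal; ring).
  apply is_lim_seq_plus'; [apply is_lim_seq_const|].
  replace (Finite 0) with (Finite (Rabs (1 - 1))) by (f_equal; rewrite Rminus_diag; apply Rabs_R0).
  apply (is_lim_seq_abs (fun n => Y n - 1) (1 - 1)).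
  apply is_lim_seq_minus'; [exact HY|apply is_lim_seq_const].
Qed.

Theorem theorem4p5 :
  forall rho : R, 1 < rho ->
  exists K1 K2 : nat -> R,
    (forall n : nat, 0 < K1 n) /\ is_lim_seq K1 1 /\
    (forall n : nat, 0 < K2 n) /\ is_lim_seq K2 1 /\
    forall f : C -> C,
      (forall z : C, bernstein_region rho z -> analytic_at f z) ->
      forall (n : nat) (x : nat -> R) (p : C -> C),
        (1 <= n)%nat ->
        is_LGL_points n x ->
        is_poly_deg_le n p ->
        (forall j : nat, (j <= n)%nat -> p (RtoC (x j)) = f (RtoC (x j))) ->
        Rbar_le
          (sup_norm Omega (fun z => (f z - p z)%C))
          (Finite (K1 n * sqrt 2 * M_ellipse f rho * L_ellipse rho
                   / (set_dist Omega (bernstein_ellipse rho) * PI * sqrt (rho ^ 2 - 1))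
                   * (1 / rho ^ n))) /\
        (forall j : nat, (j <= n)%nat ->
          Cmod (C_derive f (RtoC (x j)) - C_derive p (RtoC (x j))) <=
          K2 n * sqrt 2 * M_ellipse f rho * L_ellipse rho
          / (set_dist Omega (bernstein_ellipse rho) * sqrt (PI * (rho ^ 2 - 1)))
          * (Rpower (INR n) (3 / 2) / rho ^ n)).
Proof.
intros rho Hr.
assert (HKpos : forall n, 0 < bound_const rho n).
{ intros n. unfold bound_const. eapply Rlt_le_trans; [apply Rlt_0_1|apply Rmax_l]. }
exists (bound_const rho), (bound_const rho).
split; [exact HKpos|]. split; [now apply bound_const_lim|].
split; [exact HKpos|]. split; [now apply bound_const_lim|].
intros f Hf n x p Hn Hx Hp Hpf.
set (d := set_dist Omega (bernstein_ellipse rho)).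
assert (Hd : 0 < d) by now apply set_dist_ellipse.
set (m := phi_min rho n). assert (Hm : 0 < m) by now apply phi_min_pos.
assert (HE := interpolation_error rho f n x p m Hr Hf Hn Hx Hp Hpf Hm
  (fun th => phi_min_le rho n x th Hr Hn Hx)). fold d in HE.
assert (HM : 0 <= M_ellipse f rho).
{ eapply Rle_trans; [apply Cmod_ge_0|]. now apply (M_ellipse_bound rho f 0). }
pose proof PI_RGT_0 as Hpi.
assert (HL : 0 <= L_ellipse rho).
{ rewrite L_ellipse_eq by lra. apply RInt_ge_0; [lra| |intros; apply Cmod_ge_0].
  apply (ex_RInt_continuous (V := R_CompleteNormedModule)). intros th _.
  apply (Ccont_Cmod (ellipse' rho)). intros s. apply Ccont2_ellipse'. }
set (ML := M_ellipse f rho * L_ellipse rho) in *.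
assert (HML : 0 <= ML) by now apply Rmult_le_pos.
set (s := sqrt (rho ^ 2 - 1)). assert (Hs : 0 < s) by (apply sqrt_lt_R0; nra).
set (K := bound_const rho n).
pose proof (cbin_pos n) as Hg. pose proof (pow_lt rho n ltac:(lra)) as Hp0.
assert (HI : 1 <= INR n) by now apply (le_INR 1).
assert (HK : (1 + / 2 * / INR n) * / m <= K * / (cbin n * rho ^ n * s)).
{ assert (HK0 : (1 + / 2 * / INR n) * (cbin n * rho ^ n * s) / m <= K) by apply Rmax_r.
  assert (Hq : 0 < cbin n * rho ^ n * s) by (repeat apply Rmult_lt_0_compat; lra).
  apply Rmult_le_reg_r with (cbin n * rho ^ n * s); [easy|].
  replace (K * / (cbin n * rho ^ n * s) * (cbin n * rho ^ n * s)) with K by (field; lra).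
  eapply Rle_trans; [|exact HK0]. right. field. lra. }
assert (H2 : 0 < sqrt 2) by (apply sqrt_lt_R0; lra).
assert (Hpd : 0 < PI * d) by now apply Rmult_lt_0_compat.
assert (Hden : 0 < 2 * PI * d * m) by (apply Rmult_lt_0_compat; lra).
assert (Hps : 0 < PI * d * rho ^ n * s) by (repeat (apply Rmult_lt_0_compat; [|easy]); easy).
split.
- destruct (Lub_Rbar_correct (fun y => exists z : C, Omega z /\ y = Cmod (f z - p z))) as [_ Hlub].
  apply Hlub. intros v (z & (y & Hy & ->) & ->).
  eapply Rle_trans; [now apply HE|].
  apply Rle_trans with (ML / (2 * PI * d * m) * (sqrt 2 * (cbin n * (2 * INR n + 1) / INR n))).
  + apply Rmult_le_compat_l; [|now apply phi_bound].
    now apply Rdiv_le_0_compat.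
  + replace (ML / (2 * PI * d * m) * (sqrt 2 * (cbin n * (2 * INR n + 1) / INR n)))
      with (ML * sqrt 2 * cbin n / (PI * d) * ((1 + / 2 * / INR n) * / m)) by (field; lra).
    apply Rle_trans with (ML * sqrt 2 * cbin n / (PI * d) * (K * / (cbin n * rho ^ n * s))).
    * apply Rmult_le_compat_l; [|exact HK].
      apply Rdiv_le_0_compat; [|exact Hpd]. repeat apply Rmult_le_pos; lra.
    * right. unfold ML. field. lra.
- intros j Hj.
  eapply Rle_trans; [apply (interpolation_derive_error rho f n x p (ML / (2 * PI * d * m))); auto|].
  { now apply Rdiv_le_0_compat. }
  rewrite sqrt_mult by nra. fold s.
  set (q := sqrt PI). assert (Hq : 0 < q) by now apply sqrt_lt_R0.
  assert (Hqq : q * q = PI) by (apply sqrt_sqrt; lra).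
  set (w := sqrt (INR n)). assert (Hw : 0 < w) by (apply sqrt_lt_R0; lra).
  assert (Hpow : Rpower (INR n) (3 / 2) = INR n * w).
  { replace (3 / 2) with (1 + / 2) by field.
    rewrite Rpower_plus, Rpower_1, Rpower_sqrt by lra. easy. }
  (* This turns the factor n/g_n into 2 n^(3/2). *)
  assert (Hgw : / cbin n <= 2 * w).
  { rewrite <- (Rinv_inv (2 * w)). apply Rinv_le_contravar.
    - apply Rinv_0_lt_compat. lra.
    - now apply cbin_lower. }
  (* Equivalent to PI >= 2. The second bound therefore has a margin sqrt(2 PI)/2, and the same
     sequence of constants serves for both. *)
  assert (H2q : 2 <= sqrt 2 * q).
  { unfold q. rewrite <- sqrt_mult by lra. rewrite <- (sqrt_square 2) at 1 by lra.
    apply sqrt_le_1_alt. pose proof PI2_1. lra. }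
  rewrite Hpow.
  replace (ML / (2 * PI * d * m) * (2 * INR n + 1))
    with (ML * INR n / (PI * d) * ((1 + / 2 * / INR n) * / m)) by (field; lra).
  apply Rle_trans with (ML * INR n / (PI * d) * (K * / (cbin n * rho ^ n * s))).
  { apply Rmult_le_compat_l; [|exact HK].
    apply Rdiv_le_0_compat; [|exact Hpd]. apply Rmult_le_pos; lra. }
  specialize (HKpos n). fold K in HKpos.
  replace (ML * INR n / (PI * d) * (K * / (cbin n * rho ^ n * s)))
    with (ML * INR n * K / (PI * d * rho ^ n * s) * / cbin n) by (field; lra).
  replace (K * sqrt 2 * M_ellipse f rho * L_ellipse rho / (d * (q * s)) * (INR n * w / rho ^ n))
    with (ML * INR n * K / (PI * d * rho ^ n * s) * (sqrt 2 * q * w)).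
  2:{ unfold ML. rewrite <- Hqq. field. lra. }
  apply Rmult_le_compat_l.
  + apply Rdiv_le_0_compat; [|exact Hps]. apply Rmult_le_pos; [apply Rmult_le_pos|]; lra.
  + apply Rle_trans with (2 * w); [easy|]. apply Rmult_le_compat_r; lra.
Qed.
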